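(* Let $M$ be a von Neumann algebra. Every generalized derivation $T:M\to M$ is continuous. Every linear map $T:M\to M$ which is a derivation at zero is continuous, and every linear map $T:M\to M$ which is a triple derivation at zero is continuous.
   Context: Maps are not assumed continuous a priori; continuity refers to the norm topology. For $a,b,c\in M$, $\{a,b,c\}=\frac12(ab^*c+cb^*a)$. A linear map $G:M\to M$ is a generalized derivation if there exists $\xi\in M^{**}$ such that $G(ab)=G(a)b+aG(b)-a\xi b$ for all $a,b\in M$ (products taken in $M^{**}$). A linear map $T:M\to M$ is a derivation at zero if $T(a)b+aT(b)=0$ for all $a,b\in M$ with $ab=0$. It is a triple derivation at zero if $\{T(a),b,c\}+\{a,T(b),c\}+\{a,b,T(c)\}=0$ for all $a,b,c\in M$ with $\{a,b,c\}=0$. *)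

(* Defs.v *)
From HB Require Import structures.
From mathcomp Require Import all_boot all_order all_algebra.
From mathcomp Require Import all_classical all_reals topology normedtype.
From mathcomp.real_closed Require Import complex.

Set Implicit Arguments.
Unset Strict Implicit.
Unset Printing Implicit Defensive.

Import Order.TTheory GRing.Theory Num.Theory.
Import numFieldNormedType.Exports.

Local Open Scope classical_set_scope.
Local Open Scope complex_scope.
Local Open Scope ring_scope.

(** The norm of a [normedModType R[i]] takes its values in [R[i]] (in the
    nonnegative reals), hence the injections [%:C] around real bounds. *)

Section BoundedOperators.
Context {R : realType}.
Implicit Types V W : normedModType R[i].

Definition bounded_linear V W : {pred V -> W} :=
  fun f : V -> W => `[< linear f /\ continuous f >].

Arguments bounded_linear : clear implicits.

Record bounded V W := Bounded {
  bounded_fun :> V -> W;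
  boundedP : bounded_fun \in bounded_linear V W }.

HB.instance Definition _ V W := [isSub for @bounded_fun V W].
HB.instance Definition _ V W := [Choice of bounded V W by <:].

Lemma bounded_linearP V W (f : V -> W) :
  f \in bounded_linear V W <-> linear f /\ continuous f.
Proof. by split=> [/asboolP|?]; last exact/asboolP. Qed.

Lemma bounded_linear_submod V W : submod_closed (bounded_linear V W).
Proof.
split.
  apply/bounded_linearP; split; first by move=> a u v; rewrite scaler0 addr0.
  by move=> x; exact: cst_continuous.
move=> a f g /bounded_linearP[lf cf] /bounded_linearP[lg cg].
apply/bounded_linearP; split.
  move=> b u v; have E x : (a *: f + g) x = a *: f x + g x by [].
  by rewrite !E lf lg !scalerDr !scalerA [a * b]mulrC addrACA.
move=> x; apply: (@cvgD _ _ _ _ _ (fun y => a *: f y)); last exact: cg.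
by apply: cvgZr; exact: cf.
Qed.

HB.instance Definition _ V W :=
  GRing.isSubmodClosed.Build _ _ (bounded_linear V W) (bounded_linear_submod V W).
HB.instance Definition _ V W := [SubChoice_isSubLmodule of bounded V W by <:].

Lemma bounded_is_linear V W (f : bounded V W) : linear f.
Proof. by have /bounded_linearP[] := boundedP f. Qed.

Lemma bounded_continuous V W (f : bounded V W) : continuous f.
Proof. by have /bounded_linearP[] := boundedP f. Qed.

HB.instance Definition _ V W (f : bounded V W) :=
  GRing.isLinear.Build _ _ _ _ f (bounded_is_linear f).

Lemma normC_Re V (x : V) : `|x| = (complex.Re `|x|)%:C.
Proof. by rewrite RRe_real// normr_real. Qed.

Definition opnorm V W (f : bounded V W) : R[i] :=
  (inf [set k : R | 0 <= k /\ forall x, `|f x| <= k%:C * `|x|])%:C.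

Lemma linear_bound_bounded V W (f : V -> W) (k : R[i]) :
  linear f -> (forall x, `|f x| <= k * `|x|) -> f \in bounded_linear V W.
Proof.
move=> lf fk; apply/bounded_linearP; split=> //.
pose g : {linear V -> W} := HB.pack f (GRing.isLinear.Build _ _ _ _ f lf).
apply: (@bounded_linear_continuous _ _ _ g); apply/ex_bound.
exists `|k|; apply/nbhs_norm0P; exists 1 => //= x /= x1.
have kx : 0 <= k * `|x| by exact: le_trans (fk x).
rewrite (le_trans (fk x))// -(ger0_norm kx) normrM normr_id ler_piMr//.
exact: ltW.
Qed.

Lemma bounded_bound V W (f : bounded V W) :
  [set k : R | 0 <= k /\ forall x, `|f x| <= k%:C * `|x|] !=set0.
Proof.
have := continuous_linear_bounded 0 (@bounded_continuous V W f 0).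
move=> /linear_boundedP/pinfty_ex_gt0[k k0 fk]; exists (complex.Re k).
have kE : (complex.Re k)%:C = k by rewrite RRe_real// gtr0_real.
by split=> [|x]; [rewrite -lecR kE; exact: (ltW k0)|rewrite kE; exact: fk].
Qed.

Lemma opnorm_ge0 V W (f : bounded V W) : 0 <= opnorm f.
Proof. by rewrite lecR; apply: lb_le_inf; [exact: bounded_bound|move=> k []]. Qed.

Lemma le_opnorm V W (f : bounded V W) x : `|f x| <= opnorm f * `|x|.
Proof.
have [->|x0] := eqVneq x 0; first by rewrite linear0 !normr0 mulr0.
rewrite -ler_pdivrMr ?normr_gt0//.
rewrite -[leLHS]ger0_norm ?divr_ge0// (@normC_Re R[i]^o) lecR.
apply: lb_le_inf; first exact: bounded_bound.
move=> k [k0 fk]; rewrite -lecR -(@normC_Re R[i]^o) ger0_norm ?divr_ge0//.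
by rewrite ler_pdivrMr ?normr_gt0.
Qed.

Lemma opnorm_le V W (f : bounded V W) (k : R[i]) :
  0 <= k -> (forall x, `|f x| <= k * `|x|) -> opnorm f <= k.
Proof.
move=> k0 fk; have kE : k = (complex.Re k)%:C by rewrite RRe_real// ger0_real.
rewrite kE lecR; apply: ge_inf; first by exists 0 => j [].
by split=> [|x]; rewrite -?lecR -kE.
Qed.

Lemma opnormD V W (f g : bounded V W) : opnorm (f + g) <= opnorm f + opnorm g.
Proof.
apply: opnorm_le => [|x]; first by rewrite addr_ge0 ?opnorm_ge0.
by rewrite (le_trans (ler_normD _ _))// mulrDl lerD// le_opnorm.
Qed.

Lemma opnorm_eq0 V W (f : bounded V W) : opnorm f = 0 -> f = 0.
Proof.
move=> f0; apply/val_inj/funext => x /=; apply/eqP; rewrite -normr_le0.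
by rewrite (le_trans (le_opnorm f x))// f0 mul0r.
Qed.

Lemma opnormZ V W a (f : bounded V W) : opnorm (a *: f) = `|a| * opnorm f.
Proof.
have le b (g : bounded V W) : opnorm (b *: g) <= `|b| * opnorm g.
  apply: opnorm_le => [|x]; first by rewrite mulr_ge0 ?opnorm_ge0.
  by rewrite /= [X in X <= _]normrZ -mulrA ler_wpM2l// le_opnorm.
apply/eqP; rewrite eq_le le/=; have [->|a0] := eqVneq a 0.
  by rewrite normr0 mul0r opnorm_ge0.
by rewrite -ler_pdivlMl ?normr_gt0// -normfV -{1}[f](scalerK a0) le.
Qed.

HB.instance Definition _ V W :=
  Lmodule_isNormed.Build R[i] (bounded V W) (@opnormD V W)
    (@opnormZ V W) (@opnorm_eq0 V W).

Definition dual V := bounded V R[i]^o.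
Definition bidual V := dual (dual V).

Lemma embed_subproof V (x : V) :
  (fun phi : dual V => phi x : R[i]^o) \in bounded_linear (dual V) R[i]^o.
Proof.
apply: (@linear_bound_bounded _ _ _ `|x|) => [a f g //|f].
by rewrite mulrC le_opnorm.
Qed.
Definition embed V (x : V) : bidual V := Bounded (embed_subproof x).

End BoundedOperators.

Arguments bounded_linear {R} V W.
Arguments bounded {R} V W.

Section OperatorAlgebra.
Context {R : realType} {V : normedModType R[i]}.
Implicit Types a b c : bounded V V.

Lemma opmul_subproof a b : (a \o b : V -> V) \in bounded_linear V V.
Proof.
apply: (@linear_bound_bounded _ _ _ _ (opnorm a * opnorm b)).
  by move=> k u v /=; rewrite !linearP.
move=> x /=; rewrite (le_trans (le_opnorm a _))// -mulrA.
by rewrite ler_wpM2l ?opnorm_ge0 ?le_opnorm.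
Qed.
Definition opmul a b : bounded V V := Bounded (opmul_subproof a b).

Lemma opone_subproof : (idfun : V -> V) \in bounded_linear V V.
Proof.
by apply: (@linear_bound_bounded _ _ _ _ 1) => // x; rewrite mul1r.
Qed.
Definition opone : bounded V V := Bounded opone_subproof.

Lemma opmulA : associative opmul.
Proof. by move=> a b c; apply/val_inj. Qed.
Lemma opmul1l : left_id opone opmul.
Proof. by move=> a; apply/val_inj. Qed.
Lemma opmul1r : right_id opone opmul.
Proof. by move=> a; apply/val_inj. Qed.
Lemma opmulDl : left_distributive opmul +%R.
Proof. by move=> a b c; apply/val_inj. Qed.
Lemma opmulDr : right_distributive opmul +%R.
Proof. by move=> a b c; apply/val_inj/funext => x; exact: (linearD a). Qed.

HB.instance Definition _ := GRing.Zmodule_isPzRing.Build (bounded V V)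
  opmulA opmul1l opmul1r opmulDl opmulDr.

Lemma opmulE a b x : (a * b) x = a (b x). Proof. by []. Qed.

Lemma opscaleAl (k : R[i]) a b : k *: (a * b) = (k *: a) * b.
Proof. exact/val_inj. Qed.

Lemma opscaleAr (k : R[i]) a b : k *: (a * b) = a * (k *: b).
Proof. by apply/val_inj/funext => x; symmetry; exact: (linearZ_LR a k (b x)). Qed.

Lemma opnormM a b : `|a * b| <= `|a| * `|b|.
Proof.
apply: opnorm_le => [|x]; first by rewrite mulr_ge0.
rewrite opmulE (le_trans (le_opnorm a _))// -mulrA.
by rewrite ler_wpM2l ?opnorm_ge0 ?le_opnorm.
Qed.

Definition commutant (S : set (bounded V V)) : set (bounded V V) :=
  [set b | forall a, S a -> a * b = b * a].

End OperatorAlgebra.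

Record hilbert (R : realType) := Hilbert {
  hilbert_sort :> completeNormedModType R[i];
  dot : {dot hilbert_sort for Num.conj};
  dotxx : forall x, dot x x = `|x| ^+ 2 }.

Definition adjoint {R : realType} {H : hilbert R} (a b : bounded H H) : Prop :=
  forall x y : H, dot H (a x) y = dot H x (b y).

Lemma adjoint_sym {R : realType} {H : hilbert R} (a b : bounded H H) :
  adjoint a b -> adjoint b a.
Proof.
move=> ab x y; rewrite hermC/= expr0 mul1r -ab.
by rewrite [in RHS]hermC/= expr0 mul1r.
Qed.

Lemma adjoint_inj {R : realType} {H : hilbert R} (a b c : bounded H H) :
  adjoint a b -> adjoint a c -> b = c.
Proof.
move=> ab ac; apply/val_inj/funext => y; apply/eqP; rewrite -subr_eq0 -normr_eq0.
rewrite -sqrf_eq0 -dotxx linearBr/= -ab -ac subrr.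
by [].
Qed.

(** A self-adjoint set of operators equal to its bicommutant; it is then
    automatically a unital *-subalgebra of [B(H)]. *)
Record vonNeumann (R : realType) (H : hilbert R) := VonNeumann {
  vn_set : set (bounded H H);
  vn_selfadjoint : forall a, vn_set a -> exists2 b, vn_set b & adjoint a b;
  vn_bicommutant : commutant (commutant vn_set) = vn_set }.

Section VonNeumann.
Context {R : realType} {H : hilbert R} (M : vonNeumann H).

Definition vn_pred : {pred bounded H H} := fun a => `[< vn_set M a >].

Lemma vn_predP a : a \in vn_pred <->
  forall b, commutant (vn_set M) b -> b * a = a * b.
Proof.
split=> [/asboolP|h]; first by rewrite -{1}vn_bicommutant => h b /h.
by apply/asboolP; rewrite -vn_bicommutant => b /h.
Qed.

Lemma vn_subring : subring_closed vn_pred.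
Proof.
split=> [|a b|a b].
- by apply/vn_predP => c _; rewrite mulr1 mul1r.
- move=> /vn_predP aM /vn_predP bM; apply/vn_predP => c cM.
  by rewrite mulrBr mulrBl aM ?bM.
- move=> /vn_predP aM /vn_predP bM; apply/vn_predP => c cM.
  by rewrite mulrA aM// -mulrA bM// mulrA.
Qed.
HB.instance Definition _ := GRing.isSubringClosed.Build _ vn_pred vn_subring.

Lemma vn_scale : GRing.scaler_closed vn_pred.
Proof.
move=> k a /vn_predP aM; apply/vn_predP => c cM.
by rewrite -opscaleAl -opscaleAr aM.
Qed.
HB.instance Definition _ := GRing.isScaleClosed.Build _ _ vn_pred vn_scale.

Record vn_type := VN { vn_val :> bounded H H; vnP : vn_val \in vn_pred }.

HB.instance Definition _ := [isSub for vn_val].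
HB.instance Definition _ := [Choice of vn_type by <:].
HB.instance Definition _ := 
  GRing.SubChoice_isSubPzRing.Build _ _ vn_type (subringClosedP _).
HB.instance Definition _ := [SubZmodule_isSubLmodule of vn_type by <:].

Definition vn_norm (a : vn_type) : R[i] := `|vn_val a|.

Lemma vn_normD a b : vn_norm (a + b) <= vn_norm a + vn_norm b.
Proof. exact: ler_normD. Qed.
Lemma vn_normZ k a : vn_norm (k *: a) = `|k| * vn_norm a.
Proof. exact: normrZ. Qed.
Lemma vn_norm_eq0 a : vn_norm a = 0 -> a = 0.
Proof. by move=> a0; apply/val_inj/normr0_eq0. Qed.

HB.instance Definition _ :=
  Lmodule_isNormed.Build R[i] vn_type vn_normD vn_normZ vn_norm_eq0.

End VonNeumann.

Arguments vn_type {R H} M.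
Coercion vn_type : vonNeumann >-> Sortclass.

Section Derivations.
Context {R : realType} {H : hilbert R} {M : vonNeumann H}.
Implicit Types (a b c : M) (phi : dual M) (xi eta : bidual M).

Lemma vn_normM a b : `|a * b| <= `|a| * `|b|.
Proof. exact: opnormM. Qed.

Lemma vn_scaleAl (k : R[i]) a b : k *: (a * b) = (k *: a) * b.
Proof. exact/val_inj/opscaleAl. Qed.

Lemma vn_scaleAr (k : R[i]) a b : k *: (a * b) = a * (k *: b).
Proof. exact/val_inj/opscaleAr. Qed.

Lemma star_subproof a : exists b, adjoint (vn_val a) (vn_val b).
Proof.
have /asboolP/vn_selfadjoint[b Mb ab] := vnP a.
by exists (VN (asboolT Mb)).
Qed.
(** The choice is harmless: adjoints are unique by [adjoint_inj]. *)
Definition star a : M := projT1 (cid (star_subproof a)).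

Lemma starP a : adjoint (vn_val a) (vn_val (star a)).
Proof. by rewrite /star; case: cid. Qed.

(** The (first) Arens product of [M**], in three steps:
    [(phi . a) x = phi (a x)], [(eta . phi) a = eta (phi . a)] and
    [(xi eta) phi = xi (eta . phi)]. *)

Lemma dual_act_subproof phi a :
  (fun x : M => phi (a * x)) \in bounded_linear M R[i]^o.
Proof.
apply: (@linear_bound_bounded _ _ _ _ (`|phi| * `|a|)) => [k x y|x].
  by rewrite mulrDr -vn_scaleAr linearP.
rewrite (le_trans (le_opnorm phi _))// -mulrA.
by rewrite ler_wpM2l ?opnorm_ge0 ?vn_normM.
Qed.
Definition dual_act phi a : dual M := Bounded (dual_act_subproof phi a).

Lemma norm_dual_act phi a : `|dual_act phi a| <= `|phi| * `|a|.
Proof.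
apply: opnorm_le => [|x]; first by rewrite mulr_ge0.
rewrite (le_trans (le_opnorm phi _))// -mulrA.
by rewrite ler_wpM2l ?opnorm_ge0 ?vn_normM.
Qed.

Lemma bidual_act_subproof eta phi :
  (fun a : M => eta (dual_act phi a)) \in bounded_linear M R[i]^o.
Proof.
apply: (@linear_bound_bounded _ _ _ _ (`|eta| * `|phi|)) => [k a b|a].
  rewrite -linearP; congr (eta _); apply/val_inj/funext => x /=.
  by rewrite mulrDl -vn_scaleAl linearP.
rewrite (le_trans (le_opnorm eta _))// -mulrA.
by rewrite ler_wpM2l ?opnorm_ge0 ?norm_dual_act.
Qed.
Definition bidual_act eta phi : dual M := Bounded (bidual_act_subproof eta phi).

Lemma norm_bidual_act eta phi : `|bidual_act eta phi| <= `|eta| * `|phi|.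
Proof.
apply: opnorm_le => [|a]; first by rewrite mulr_ge0.
rewrite (le_trans (le_opnorm eta _))// -mulrA.
by rewrite ler_wpM2l ?opnorm_ge0 ?norm_dual_act.
Qed.

Lemma arens_subproof xi eta :
  (fun phi : dual M => xi (bidual_act eta phi) : R[i]^o)
    \in bounded_linear (dual M) R[i]^o.
Proof.
apply: (@linear_bound_bounded _ _ _ _ (`|xi| * `|eta|)) => [k f g|f].
  rewrite -linearP; congr (xi _); apply/val_inj/funext => a /=.
  rewrite -[RHS](linearP eta); congr (eta _).
  exact/val_inj/funext.
rewrite (le_trans (le_opnorm xi _))// -mulrA.
by rewrite ler_wpM2l ?opnorm_ge0 ?norm_bidual_act.
Qed.
Definition arens xi eta : bidual M := Bounded (arens_subproof xi eta).

Lemma arens_embed a b : arens (embed a) (embed b) = embed (a * b).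
Proof. exact/val_inj/funext. Qed.

Definition generalized_derivation (G : M -> M) : Prop :=
  exists xi : bidual M, forall a b : M,
    embed (G (a * b)) =
      arens (embed (G a)) (embed b) + arens (embed a) (embed (G b))
      - arens (arens (embed a) xi) (embed b).

Definition derivation_at_zero (T : M -> M) : Prop :=
  forall a b : M, a * b = 0 -> T a * b + a * T b = 0.

Definition triple a b c : M :=
  2^-1 *: (a * star b * c + c * star b * a).

Definition triple_derivation_at_zero (T : M -> M) : Prop :=
  forall a b c : M, triple a b c = 0 ->
    triple (T a) b c + triple a (T b) c + triple a b (T c) = 0.

End Derivations.

(* Main.v *)
Require Import Defs.
From mathcomp Require Import all_boot all_order all_algebra.
From mathcomp Require Import all_classical all_reals topology normedtype.
From mathcomp.real_closed Require Import complex.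
From mathcomp Require Import ring lra.

Set Implicit Arguments.
Unset Strict Implicit.
Unset Printing Implicit Defensive.

Import Order.TTheory GRing.Theory Num.Theory.
Import numFieldNormedType.Exports.

(** All three hypotheses on [T] imply that [T] is local for compressions
    ([null_compression]): if [p] is a projection of [M] and [p a = a p = 0],
    then [p (T a) p = 0]. Continuity follows from this single property.

    Let [h >= 0] in [M] have [0] as the infimum of its spectrum. Then [h] and
    [T h] are simultaneously small, in quadratic form, at a common vector
    ([small_compression]). This is clear on the kernel of [h]. If [h] is
    injective and the claim fails, there is a sequence of disjoint nonzero
    spectral projections [q_n] of [h] with [h q_n] of norm at most [4 ^ - n].
    The operator [k = sum_n 2 ^ n h q_n] lies in [M] and agrees with [2 ^ n h]
    under [q_n], so by locality [q_n (T k) q_n = 2 ^ n q_n (T h) q_n]; these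
    compressions would grow without bound although [T k] is bounded.

    Apply this to [h = |a| - a] or [h = |a| + a] with [a] self-adjoint: at
    vectors where the numerical radius of [a] is nearly attained, [T a] is
    comparable with [|a| (T 1)]. Hence the real-linear map
    [S a = T a + (T a)^star] satisfies [|a| <= |a - l S a| + 2 l |T 1| |a|] for
    all real [l >= 0] ([dissipative]). An everywhere defined operator with such
    an estimate is closable, hence bounded on the Banach space of self-adjoint
    elements; [dissipative_bounded] proves this by a gliding hump. Applied to
    [T] and to [i T] it bounds [T] itself ([null_compression_continuous]).

    The analytic content of the bicommutant condition is that [M] is closed
    under strong limits of bounded sequences ([strong_limit]). Spectral
    projections come from it: the kernel projection of a self-adjoint
    contraction [b] is the strong limit of [(1 - b ^ 2) ^ n], and the subspace
    where [h <= t] is the kernel of [|h - t| + (h - t)] ([spectral_cut]). *)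

(** * Real norms and real inner products *)

Section RealNorm.
Local Open Scope ring_scope.
Local Open Scope complex_scope.
Context {R : realType}.

(** Norms take values in the complex field; the real-valued version gives access
    to the decision procedures of real arithmetic. *)
Definition nrm {V : normedModType R[i]} (x : V) : R := complex.Re `|x|.

Section Norm.
Context {V : normedModType R[i]}.
Implicit Types x y z : V.

Lemma nrmE x : `|x| = (nrm x)%:C.
Proof. exact: normC_Re. Qed.

Lemma nrm_ge0 x : 0 <= nrm x.
Proof. by rewrite -lecR -nrmE normr_ge0. Qed.

Lemma nrmD x y : nrm (x + y) <= nrm x + nrm y.
Proof. by rewrite -lecR rmorphD/= -!nrmE ler_normD. Qed.

Lemma nrmZ (k : R) x : nrm (k%:C *: x) = `|k| * nrm x.
Proof.
apply: (@complexI R); rewrite rmorphM/= -!nrmE normrZ; congr (_ * _).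
by rewrite normc_def/= expr0n addr0 sqrtr_sqr.
Qed.

Lemma nrmN x : nrm (- x) = nrm x.
Proof. by rewrite /nrm normrN. Qed.

Lemma nrmB x y : nrm (x - y) <= nrm x + nrm y.
Proof. by rewrite -(nrmN y) nrmD. Qed.

Lemma nrm_distC x y : nrm (x - y) = nrm (y - x).
Proof. by rewrite /nrm distrC. Qed.

Lemma nrm_dist_trans z x y : nrm (x - y) <= nrm (x - z) + nrm (z - y).
Proof. by apply: le_trans (nrmD _ _); rewrite addrA subrK. Qed.

Lemma nrm0 : nrm (0 : V) = 0.
Proof. by rewrite /nrm normr0. Qed.

Lemma nrm0_eq0 x : nrm x = 0 -> x = 0.
Proof. by move=> x0; apply/normr0_eq0; rewrite nrmE x0. Qed.

Lemma nrm_gt0 x : x != 0 -> 0 < nrm x.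
Proof.
move=> x0; rewrite lt_neqAle nrm_ge0 andbT eq_sym.
by apply: contra x0 => /eqP/nrm0_eq0 ->.
Qed.

Lemma nrm_eq0_small x : (forall e : R, 0 < e -> nrm x <= e) -> x = 0.
Proof.
move=> h; apply: nrm0_eq0; apply/eqP; rewrite eq_le nrm_ge0 andbT.
by apply/ler_addgt0Pl => e e0; rewrite addr0 h.
Qed.

Lemma nrm_iZ x : nrm ('i *: x) = nrm x.
Proof.
apply: (@complexI R); rewrite -!nrmE normrZ normc_def/= expr0n expr1n add0r.
by rewrite sqrtr1 mul1r.
Qed.

End Norm.

Section Hilbert.
Context {H : hilbert R}.
Implicit Types x y z : H.

(** The real inner product is enough throughout: self-adjointness, positivity and
    the numerical radius of a self-adjoint operator can be read off it. *)
Definition rip x y : R := complex.Re (dot H x y).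

Lemma ripDl x y z : rip (x + y) z = rip x z + rip y z.
Proof. by rewrite /rip linearDl raddfD. Qed.

Lemma ripC x y : rip x y = rip y x.
Proof.
by rewrite /rip hermC/= expr0 mul1r; case: (dot H y x) => a b.
Qed.

Lemma ripDr x y z : rip x (y + z) = rip x y + rip x z.
Proof. by rewrite ripC ripDl !(ripC x). Qed.

Lemma ripZl (k : R) x y : rip (k%:C *: x) y = k * rip x y.
Proof.
rewrite /rip linearZl_LR/=; case: (dot H x y) => a b /=.
by rewrite mul0r subr0.
Qed.

Lemma ripZr (k : R) x y : rip x (k%:C *: y) = k * rip x y.
Proof. by rewrite ripC ripZl ripC. Qed.

Lemma ripNl x y : rip (- x) y = - rip x y.
Proof. by rewrite /rip linearNl raddfN. Qed.

Lemma ripNr x y : rip x (- y) = - rip x y.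
Proof. by rewrite ripC ripNl ripC. Qed.

Lemma rip0l y : rip 0 y = 0.
Proof. by rewrite /rip linear0l. Qed.

Lemma ripxx x : rip x x = nrm x ^+ 2.
Proof. by rewrite /rip dotxx nrmE -rmorphXn. Qed.

Lemma rip_ge0 x : 0 <= rip x x.
Proof. by rewrite ripxx sqr_ge0. Qed.

Lemma nrm_sqD x y : nrm (x + y) ^+ 2 = nrm x ^+ 2 + 2 * rip x y + nrm y ^+ 2.
Proof. by rewrite -!ripxx ripDl !ripDr (ripC y x); ring. Qed.

(** The discriminant of [t |-> rip (x + t y) (x + t y)] is at most zero. *)
Lemma rip_CS x y : `|rip x y| <= nrm x * nrm y.
Proof.
have [->|y0] := eqVneq y 0.
  by rewrite ripC rip0l normr0 mulr_ge0 ?nrm_ge0.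
have yp := nrm_gt0 y0.
have h (t : R) : 0 <= nrm x ^+ 2 + 2 * t * rip x y + t ^+ 2 * nrm y ^+ 2.
  have := rip_ge0 (x + t%:C *: y).
  rewrite ripxx nrm_sqD nrmZ ripZr exprMn real_normK ?num_real//.
  by rewrite !mulrA.
have /= := h (- rip x y / nrm y ^+ 2).
set r := rip x y; set a := nrm x; set b := nrm y => h2.
have a0 : 0 <= a by exact: nrm_ge0.
rewrite -(ler_pXn2r (n := 2)) ?nnegrE ?mulr_ge0 ?normr_ge0 ?(ltW yp)//.
rewrite real_normK ?num_real// -subr_ge0.
suff -> : (a * b) ^+ 2 - r ^+ 2 = b ^+ 2 *
   (a ^+ 2 + 2 * (- r / b ^+ 2) * r + (- r / b ^+ 2) ^+ 2 * b ^+ 2).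
  by rewrite mulr_ge0// sqr_ge0.
by field; rewrite gt_eqF.
Qed.

Lemma rip_le x y : rip x y <= nrm x * nrm y.
Proof. exact: le_trans (ler_norm _) (rip_CS x y). Qed.

Lemma Im_dot x y : complex.Im (dot H x y) = - rip ('i *: x) y.
Proof. by rewrite /rip linearZl_LR/=; case: (dot H x y) => p q /=; ring. Qed.

Lemma norm_dot_le x y : `|dot H x y| <= (2 * (nrm x * nrm y))%:C.
Proof.
have nC (t : R) : `|t%:C| = `|t|%:C :> R[i].
  by rewrite normc_def/= expr0n addr0 sqrtr_sqr.
have -> : dot H x y = (rip x y)%:C + 'i * (- rip ('i *: x) y)%:C.
  rewrite -Im_dot /rip; case: (dot H _ _) => s t /=.
  by apply/eqP; rewrite eq_complex/=; apply/andP; split; apply/eqP; ring.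
apply: le_trans (ler_normD _ _) _.
rewrite normrM (_ : `|'i| = 1) ?mul1r; last first.
  by rewrite normc_def/= expr0n expr1n add0r sqrtr1.
rewrite !nC -rmorphD lecR normrN.
have := rip_CS x y; have := rip_CS ('i *: x) y; rewrite nrm_iZ; lra.
Qed.

End Hilbert.

End RealNorm.

(** * Sequences *)

Section Choice.
Local Open Scope ring_scope.

(** Dependent choice with an invariant [P] carried along the sequence. *)
Lemma dependent_choice_on (X : Type) (P : nat -> X -> Prop)
    (Q : nat -> X -> X -> Prop) (x0 : X) : P 0%N x0 ->
  (forall n x, P n x -> exists2 y, P n.+1 y & Q n x y) ->
  exists f : nat -> X, forall n, P n (f n) /\ Q n (f n) (f n.+1).
Proof.
move=> P0 PS.
pose next n x := if pselect (P n x) is left Pnx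
  then s2val (cid2 (PS n x Pnx)) else x0.
pose f := fix f n := if n is m.+1 then next m (f m) else x0.
have nextP n x : P n x -> P n.+1 (next n x) /\ Q n x (next n x).
  by move=> Pnx; rewrite /next; case: pselect => // Pnx'; case: cid2.
have Pf n : P n (f n) by elim: n => // n /nextP[].
by exists f => n; split=> //; case: (nextP n (f n) (Pf n)).
Qed.

Lemma expr2_unbounded (R : realType) (C : R) : exists n, C < 2 ^+ n.
Proof.
have h := archi_boundP (normr_ge0 C).
exists (Num.bound `|C|); apply: le_lt_trans (ler_norm C) _.
apply: lt_le_trans h _; rewrite -natrX ler_nat.
by apply: ltnW; exact: ltn_expl.
Qed.

End Choice.

Section Limits.
Local Open Scope classical_set_scope.
Local Open Scope ring_scope.
Local Open Scope complex_scope.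
Context {R : realType} {V : normedModType R[i]}.
Implicit Types (u v : nat -> V) (x y : V).

Definition tends u x :=
  forall e : R, 0 < e -> exists N, forall n, (N <= n)%N -> nrm (u n - x) <= e.

Definition cauchy_seq u :=
  forall e : R, 0 < e ->
    exists N, forall m n, (N <= m)%N -> (N <= n)%N -> nrm (u m - u n) <= e.

Lemma tends_uniq u x y : tends u x -> tends u y -> x = y.
Proof.
move=> ux uy; apply/subr0_eq/nrm_eq0_small => e e0.
have [N1 h1] := ux (e / 2) ltac:(lra).
have [N2 h2] := uy (e / 2) ltac:(lra).
have := h1 _ (leq_maxl N1 N2); have := h2 _ (leq_maxr N1 N2).
have := nrm_dist_trans (u (maxn N1 N2)) x y.
rewrite (nrm_distC x (u _)); lra.
Qed.

Lemma tends_cst x : tends (fun=> x) x.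
Proof. by move=> e e0; exists 0%N => n _; rewrite subrr nrm0 ltW. Qed.

Lemma tendsD u v x y :
  tends u x -> tends v y -> tends (fun n => u n + v n) (x + y).
Proof.
move=> ux vy e e0.
have [N1 h1] := ux (e / 2) ltac:(lra).
have [N2 h2] := vy (e / 2) ltac:(lra).
exists (maxn N1 N2) => n; rewrite geq_max => /andP[n1 n2].
have := h1 _ n1; have := h2 _ n2; have := nrmD (u n - x) (v n - y).
rewrite addrACA -opprD; lra.
Qed.

Lemma tendsZ (k : R[i]) u x : tends u x -> tends (fun n => k *: u n) (k *: x).
Proof.
move=> ux e e0; pose c := complex.Re `|k|.
have kE : `|k| = c%:C by exact: (@normC_Re R R[i]^o).
have c0 : 0 <= c by rewrite -lecR -kE normr_ge0.
have [N h] := ux (e / (c + 1)) ltac:(by apply: divr_gt0 => //; lra).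
exists N => n /h; rewrite -scalerBr ler_pdivlMr ?(ltr_wpDl c0)// => hn.
have -> : nrm (k *: (u n - x)) = c * nrm (u n - x).
  by apply: (@complexI R); rewrite rmorphM/= -!nrmE normrZ kE.
by have := nrm_ge0 (u n - x); nra.
Qed.

Lemma tends_shift u x : tends u x -> tends (fun n => u n.+1) x.
Proof.
by move=> ux e /ux[N h]; exists N => n Nn; apply: h; rewrite ltnW.
Qed.

Lemma tends_sub u x (s : nat -> nat) :
  (forall n, n <= s n)%N -> tends u x -> tends (fun n => u (s n)) x.
Proof.
move=> hs ux e /ux[N h]; exists N => n Nn; apply: h.
exact: leq_trans (hs n).
Qed.

Lemma tends_ball u x y (k : R) N :
  tends u x -> (forall n, (N <= n)%N -> nrm (u n - y) <= k) -> nrm (x - y) <= k.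
Proof.
move=> ux h; apply/ler_addgt0Pl => e /ux[N' h'].
have := h _ (leq_maxl N N'); have := h' _ (leq_maxr N N').
by have := nrm_dist_trans (u (maxn N N')) x y; rewrite (nrm_distC x (u _)); lra.
Qed.

Lemma tends_nrm_le u x (k : R) :
  tends u x -> (forall n, nrm (u n) <= k) -> nrm x <= k.
Proof.
move=> ux h; rewrite -[x]subr0; apply: (tends_ball (N := 0) ux) => n _.
by rewrite subr0.
Qed.

Lemma monotone_cauchy (c : nat -> R) :
  (forall n, c n.+1 <= c n) -> (forall n, 0 <= c n) -> forall e, 0 < e ->
  exists N, forall m n, (N <= m)%N -> (N <= n)%N -> `|c m - c n| <= e.
Proof.
move=> cS c0 e e0.
have cle m n : (m <= n)%N -> c n <= c m.
  elim: n => [|n IH]; first by rewrite leqn0 => /eqP ->.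
  rewrite leq_eqVlt => /orP[/eqP -> //|mn].
  exact: le_trans (cS n) (IH mn).
have hi : has_inf (range c).
  by split; [exists (c 0%N), 0%N|exists 0 => _ [n _ <-]].
have [_ [N _ <-] hN] := inf_adherent e0 hi.
have lbi n : inf (range c) <= c n by apply: ge_inf; [case: hi|exists n].
exists N => m n Nm Nn.
have := cle _ _ Nm; have := cle _ _ Nn; have := lbi m; have := lbi n.
move=> *; rewrite ler_norml; lra.
Qed.

Lemma majorant_dist (c : nat -> R) u m n :
  (forall n, nrm (u n.+1 - u n) <= c n - c n.+1) -> (n <= m)%N ->
  nrm (u m - u n) <= c n - c m.
Proof.
move=> uS; elim: m => [|m IH].
  by rewrite leqn0 => /eqP ->; rewrite !subrr nrm0.
rewrite leq_eqVlt => /orP[/eqP ->|nm]; first by rewrite !subrr nrm0.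
apply: le_trans (nrm_dist_trans (u m) _ _) _.
rewrite -(subrK (c m) (c n)) -addrA addrC.
by apply: lerD (IH nm).
Qed.

Lemma majorant_cauchy (c : nat -> R) u :
  (forall n, c n.+1 <= c n) -> (forall n, 0 <= c n) ->
  (forall n, nrm (u n.+1 - u n) <= c n - c n.+1) -> cauchy_seq u.
Proof.
move=> cS c0 uS e e0; have [N hN] := monotone_cauchy cS c0 e0.
exists N => m n Nm Nn.
wlog nm : m n Nm Nn / (n <= m)%N => [W|].
  case: (leqP n m) => [|/ltnW] nm; first exact: W.
  by rewrite nrm_distC; exact: W.
apply: le_trans (majorant_dist uS nm) _.
by apply: le_trans (ler_norm _) _; exact: hN.
Qed.

Lemma geometric_cauchy u :
  (forall n, nrm (u n.+1 - u n) <= 2^-1 ^+ n) -> cauchy_seq u.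
Proof.
move=> uS; have p0 n : 0 < 2^-1 ^+ n :> R by rewrite exprn_gt0// invr_gt0.
apply: (majorant_cauchy (c := fun n => 2 * 2^-1 ^+ n)) => n; have := p0 n.
- by rewrite exprS; lra.
- by lra.
- by have := uS n; rewrite exprS; lra.
Qed.

End Limits.

Section CompleteLimits.
Local Open Scope classical_set_scope.
Local Open Scope ring_scope.
Local Open Scope complex_scope.
Context {R : realType}.

Lemma tends_cauchy (V : completeNormedModType R[i]) (u : nat -> V) :
  cauchy_seq u -> exists x, tends u x.
Proof.
move=> hu.
have cu : cauchy (nbhs (u @ \oo)).
  apply: cauchy_exP => eps eps0.
  have eE : eps = (complex.Re eps)%:C by rewrite RRe_real// gtr0_real.
  have e0 : 0 < complex.Re eps by rewrite -ltcR -eE.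
  have [N h] := hu (complex.Re eps / 2) ltac:(lra).
  exists (u N); exists N => // n /= Nn.
  rewrite -ball_normE/=.
  rewrite eE nrmE ltcR; apply: le_lt_trans (h N n (leqnn N) Nn) _.
  by lra.
have /cauchy_cvgP/cvg_ex[x /cvgrPdist_le ux] := cu.
exists x => e e0; have e0' : 0 < e%:C by rewrite ltcR.
have [N _ h] := ux _ e0'.
by exists N => n /h /=; rewrite nrmE lecR nrm_distC.
Qed.

Lemma nrm_bounded (V W : normedModType R[i]) (f : bounded V W) x :
  nrm (f x) <= nrm f * nrm x.
Proof. by rewrite -lecR rmorphM/= -!nrmE le_opnorm. Qed.

Lemma bounded_nrm_le (V W : normedModType R[i]) (f : bounded V W) (k : R) :
  0 <= k -> (forall x, nrm (f x) <= k * nrm x) -> nrm f <= k.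
Proof.
move=> k0 h; rewrite -lecR -nrmE; apply: opnorm_le => [|x].
  by rewrite lecR.
by rewrite !nrmE -rmorphM/= lecR.
Qed.

Lemma tends_bounded (V W : normedModType R[i]) (f : bounded V W) u x :
  tends u x -> tends (fun n => f (u n)) (f x).
Proof.
move=> ux e e0; have c0 := nrm_ge0 f.
have [N h] := ux (e / (nrm f + 1)) ltac:(by apply: divr_gt0 => //; lra).
exists N => n /h; rewrite ler_pdivlMr ?(ltr_wpDl c0)// -linearB => hn.
have := nrm_bounded f (u n - x).
by have := nrm_ge0 (u n - x); nra.
Qed.

Lemma tends_rip (H : hilbert R) (u v : nat -> H) x y z w :
  tends u x -> tends v y -> (forall n, rip (u n) z = rip (v n) w) ->
  rip x z = rip y w.
Proof.
move=> ux vy h; apply/eqP; rewrite -subr_eq0 -normr_le0.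
apply/ler_addgt0Pl => e e0; rewrite addr0.
have z0 := nrm_ge0 z; have w0 := nrm_ge0 w.
pose d := e / (nrm z + nrm w + 1).
have dE : d * (nrm z + nrm w + 1) = e by rewrite divfK// gt_eqF//; lra.
have d0 : 0 < d by apply: divr_gt0 => //; lra.
have [N1 h1] := ux d d0; have [N2 h2] := vy d d0.
pose n := maxn N1 N2.
have {}h1 := h1 n (leq_maxl N1 N2); have {}h2 := h2 n (leq_maxr N1 N2).
have -> : rip x z - rip y w = rip (v n - y) w - rip (u n - x) z.
  by rewrite !ripDl !ripNl h; lra.
have a1 := rip_CS (v n - y) w; have a2 := rip_CS (u n - x) z.
have := ler_normB (rip (v n - y) w) (rip (u n - x) z).
have := ler_wpM2r z0 h1; have := ler_wpM2r w0 h2.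
have : e = d * nrm z + d * nrm w + d by rewrite -dE; ring.
clearbody d n; lra.
Qed.

End CompleteLimits.

(** * Operators in a von Neumann algebra *)

Section Operators.
Local Open Scope classical_set_scope.
Local Open Scope ring_scope.
Local Open Scope complex_scope.
Context {R : realType} {H : hilbert R} {M : vonNeumann H}.
Implicit Types (a b c : M) (x y z : H) (u : nat -> M).

Lemma nrm_app a x : nrm (a x) <= nrm a * nrm x.
Proof. exact: (nrm_bounded (vn_val a)). Qed.

Lemma op_nrm_le a (k : R) :
  0 <= k -> (forall x, nrm (a x) <= k * nrm x) -> nrm a <= k.
Proof. exact: (@bounded_nrm_le _ _ _ (vn_val a)). Qed.

Lemma op_nrmM a b : nrm (a * b) <= nrm a * nrm b.
Proof.
by rewrite -lecR rmorphM/= -!nrmE vn_normM.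
Qed.

Lemma op_nrm1 : nrm (1 : M) <= 1.
Proof. by apply: op_nrm_le => // x; rewrite mul1r. Qed.

Lemma op_ext a b : (forall x, a x = b x) -> a = b.
Proof. by move=> h; apply/val_inj/val_inj/funext. Qed.

Lemma opD a b x : (a + b) x = a x + b x. Proof. by []. Qed.
Lemma opN a x : (- a) x = - a x. Proof. by []. Qed.
Lemma opB a b x : (a - b) x = a x - b x. Proof. by []. Qed.
Lemma opM a b x : (a * b) x = a (b x). Proof. by []. Qed.
Lemma op1 x : (1 : M) x = x. Proof. by []. Qed.
Lemma op0 x : (0 : M) x = 0. Proof. by []. Qed.
Lemma opZ (k : R[i]) a x : (k *: a) x = k *: a x. Proof. by []. Qed.
Lemma opS a n x : (a ^+ n.+1) x = a ((a ^+ n) x). Proof. by rewrite exprS. Qed.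

Definition opE := (opD, opN, opM, op1, op0, opZ).

(** The bicommutant is closed under strong limits of bounded sequences:
    commuting with a fixed operator passes to pointwise limits. *)
Lemma strong_limit u (K : R) :
  (forall n, nrm (u n) <= K) -> (forall x, cauchy_seq (fun n => u n x)) ->
  exists a, forall x, tends (fun n => u n x) (a x).
Proof.
move=> uK uc.
have K0 : 0 <= K := le_trans (nrm_ge0 (u 0%N)) (uK 0%N).
pose f x := projT1 (cid (tends_cauchy (uc x))).
have fP x : tends (fun n => u n x) (f x) by rewrite /f; case: cid.
have lf : linear f.
  move=> k x y; apply: tends_uniq (fP _) _.
  have := tendsD (tendsZ k (fP x)) (fP y).
  by under [X in tends X _]eq_fun => n do rewrite -linearP.
have bf : f \in bounded_linear H H.
  apply: (@linear_bound_bounded _ _ _ _ K%:C) => // x.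
  rewrite !nrmE -rmorphM lecR; apply: (tends_nrm_le (fP x)) => n.
  by apply: le_trans (nrm_app _ _) _; rewrite ler_wpM2r ?nrm_ge0.
have Mf : Bounded bf \in vn_pred M.
  apply/vn_predP => b bM; apply/val_inj/funext => x.
  apply: (@tends_uniq _ _ (fun n => b (u n x))).
    exact: (tends_bounded b (fP x)).
  have -> : (fun n => b (u n x)) = (fun n => u n (b x)).
    apply/funext => n; have /vn_predP/(_ _ bM) := vnP (u n).
    by move=> /(congr1 (fun g : bounded H H => g x)).
  exact: fP.
by exists (VN Mf).
Qed.

Lemma tends_app u a x :
  tends u a -> tends (fun n => u n x) (a x).
Proof.
move=> ua e e0; have x0 := nrm_ge0 x.
have [N h] := ua (e / (nrm x + 1)) ltac:(by apply: divr_gt0 => //; lra).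
exists N => n /h; rewrite ler_pdivlMr ?(ltr_wpDl x0)// => hn.
have := nrm_app (u n - a) x; rewrite opB.
by have := nrm_ge0 (u n - a); nra.
Qed.

(** A norm-Cauchy sequence has a strong limit in [M], to which it converges in
    norm because closed balls are strongly closed. *)
Lemma op_complete u : cauchy_seq u -> exists a, tends u a.
Proof.
move=> uc.
have [N0 h0] := uc 1 ltr01.
pose v n := u (N0 + n)%N.
have vK n : nrm (v n) <= nrm (u N0) + 1.
  have := h0 _ _ (leq_addr n N0) (leqnn N0).
  have := nrmD (u (N0 + n)%N - u N0) (u N0); rewrite subrK /v; lra.
have vx x : cauchy_seq (fun n => v n x).
  move=> e e0; have x0 := nrm_ge0 x.
  have [N h] := uc (e / (nrm x + 1)) ltac:(by apply: divr_gt0 => //; lra).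
  exists N => m n Nm Nn.
  have := h _ _ (leq_trans Nm (leq_addl N0 m)) (leq_trans Nn (leq_addl N0 n)).
  rewrite ler_pdivlMr ?(ltr_wpDl x0)// => hn.
  have := nrm_app (v m - v n) x; rewrite opB.
  by have := nrm_ge0 (v m - v n); rewrite /v in hn *; nra.
have [a ha] := strong_limit vK vx; exists a => e e0.
have [N h] := uc e e0; exists N => n Nn.
apply: op_nrm_le => [|x]; first exact: ltW.
rewrite opB nrm_distC.
apply: (tends_ball (N := N) (ha x)) => m Nm.
have := nrm_app (v m - u n) x; rewrite opB => /le_trans; apply.
rewrite ler_wpM2r ?nrm_ge0//; apply: h => //.
exact: leq_trans Nm (leq_addl _ _).
Qed.

(** Self-adjointness for the real inner product only; it gives [star a = a]
    because complex linearity recovers the imaginary parts, see [star_eq]. *)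
Definition rsa a := forall x y, rip (a x) y = rip x (a y).

Lemma rip_star a x y : rip (a x) y = rip x (star a y).
Proof. by rewrite /rip starP. Qed.

Lemma star_eq a b : (forall x y, rip (a x) y = rip x (b y)) -> star a = b.
Proof.
move=> h; apply/val_inj; apply: (adjoint_inj (starP a)) => x y.
apply/eqP; rewrite eq_complex; apply/andP; split; apply/eqP; first exact: h.
by rewrite !Im_dot -h linearZ.
Qed.

Lemma rsa_star a : rsa a -> star a = a.
Proof. exact: star_eq. Qed.

Lemma star_rsa a : star a = a -> rsa a.
Proof. by move=> aa x y; rewrite rip_star aa. Qed.

Lemma starK a : star (star a) = a.
Proof. by apply: star_eq => x y; rewrite ripC -rip_star ripC. Qed.

Lemma starD a b : star (a + b) = star a + star b.
Proof. by apply: star_eq => x y; rewrite !opE ripDl ripDr !rip_star. Qed.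

Lemma starN a : star (- a) = - star a.
Proof. by apply: star_eq => x y; rewrite !opE ripNl ripNr !rip_star. Qed.

Lemma starZ (k : R) a : star (k%:C *: a) = k%:C *: star a.
Proof. by apply: star_eq => x y; rewrite !opE ripZl ripZr !rip_star. Qed.

(** [|a^star x| ^ 2 = <a (a^star x), x>]. *)
Lemma nrm_star a : nrm (star a) <= nrm a.
Proof.
apply: op_nrm_le => [|x]; first exact: nrm_ge0.
have [->|x0] := eqVneq (star a x) 0.
  by rewrite nrm0 mulr_ge0 ?nrm_ge0.
rewrite -(ler_pM2r (nrm_gt0 x0)) -expr2 -ripxx -rip_star.
apply: le_trans (rip_le _ _) _; rewrite mulrAC ler_wpM2r ?nrm_ge0//.
exact: nrm_app.
Qed.

Lemma rsa1 : rsa 1. Proof. by []. Qed.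
Lemma rsa0 : rsa 0. Proof. by move=> x y; rewrite !op0 rip0l ripC rip0l. Qed.

Lemma rsaD a b : rsa a -> rsa b -> rsa (a + b).
Proof. by move=> ra rb x y; rewrite !opE ripDl ripDr ra rb. Qed.

Lemma rsaN a : rsa a -> rsa (- a).
Proof. by move=> ra x y; rewrite !opE ripNl ripNr ra. Qed.

Lemma rsaB a b : rsa a -> rsa b -> rsa (a - b).
Proof. by move=> ra /rsaN; exact: rsaD. Qed.

Lemma rsaZ (k : R) a : rsa a -> rsa (k%:C *: a).
Proof. by move=> ra x y; rewrite !opE ripZl ripZr ra. Qed.

Lemma rsaM a b : rsa a -> rsa b -> GRing.comm a b -> rsa (a * b).
Proof. by move=> ra rb ab x y; rewrite ab opM rb ra -!opM ab. Qed.

Lemma rsaX a n : rsa a -> rsa (a ^+ n).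
Proof.
move=> ra; elim: n => [|n IH]; first exact: rsa1.
by rewrite exprS; apply: rsaM => //; exact: commrX.
Qed.

Lemma rsa_lim u a : (forall n, rsa (u n)) ->
  (forall x, tends (fun n => u n x) (a x)) -> rsa a.
Proof.
move=> ru ua x y; rewrite [RHS]ripC.
apply: (tends_rip (ua x) (ua y)) => n.
by rewrite ru ripC.
Qed.

Lemma tends_comm u a b : (forall n, GRing.comm (u n) b) ->
  (forall x, tends (fun n => u n x) (a x)) -> GRing.comm a b.
Proof.
move=> ub ua; apply: op_ext => x; rewrite !opM.
apply: tends_uniq (ua _) _.
have := tends_bounded (vn_val b) (ua x).
congr (tends _ _); apply/funext => n.
by rewrite -[LHS]opM -ub.
Qed.

(** Polarise the quadratic form of [a] at [x] and at [a x] scaled to the length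
    of [x]. *)
Lemma numerical_radius a (t : R) : rsa a -> 0 <= t ->
  (forall x, `|rip (a x) x| <= t * nrm x ^+ 2) -> nrm a <= t.
Proof.
move=> ra t0 h; apply: op_nrm_le => // x.
have [y0|y0] := eqVneq (a x) 0; first by rewrite y0 nrm0 mulr_ge0 ?nrm_ge0.
have x0 : x != 0 by apply: contra y0 => /eqP ->; rewrite linear0.
have yp := nrm_gt0 y0; have xp := nrm_gt0 x0.
set s := nrm x / nrm (a x).
have := h (x + s%:C *: a x); have := h (x - s%:C *: a x).
rewrite !linearD linearN/= linearZ/= !nrm_sqD.
rewrite !(ripDl, ripDr, ripNl, ripNr, ripZl, ripZr, nrmN, nrmZ).
rewrite (ra (a x) x) ripxx !ler_norml => /andP[h1 _] /andP[_ h2].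
have sE : `|s| * nrm (a x) = nrm x.
  by rewrite ger0_norm ?divr_ge0 ?nrm_ge0// divfK// gt_eqF.
rewrite sE in h1 h2.
have sE2 : s * nrm (a x) ^+ 2 = nrm x * nrm (a x).
  by rewrite expr2 mulrA divfK// gt_eqF.
have h3 : nrm x * nrm (a x) <= nrm x * (t * nrm x).
  rewrite sE2 in h1 h2; nra.
by rewrite ler_pM2l in h3.
Qed.

End Operators.

(** * Square roots and spectral projections *)

Section SpectralCuts.
Local Open Scope classical_set_scope.
Local Open Scope ring_scope.
Local Open Scope complex_scope.
Context {R : realType} {H : hilbert R} {M : vonNeumann H}.
Implicit Types (a b c : M) (x y z : H) (u : nat -> M).

Lemma tendsM u (v : nat -> M) a b (K : R) : (forall n, nrm (u n) <= K) ->
  tends u a -> tends v b -> tends (fun n => u n * v n) (a * b).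
Proof.
move=> uK ua vb e e0.
have K0 : 0 <= K := le_trans (nrm_ge0 (u 0%N)) (uK 0%N).
have b0 := nrm_ge0 b.
pose d := e / (K + nrm b + 1).
have dE : d * (K + nrm b + 1) = e by rewrite divfK// gt_eqF//; lra.
have d0 : 0 < d by apply: divr_gt0 => //; lra.
have [N1 h1] := ua d d0; have [N2 h2] := vb d d0.
exists (maxn N1 N2) => n; rewrite geq_max => /andP[/h1{}h1 /h2{}h2].
have -> : u n * v n - a * b = u n * (v n - b) + (u n - a) * b.
  by rewrite mulrBr mulrBl addrA subrK.
have := op_nrmM (u n) (v n - b); have := op_nrmM (u n - a) b.
have := nrmD (u n * (v n - b)) ((u n - a) * b).
have := ler_wpM2r b0 h1.
have := ler_pM (nrm_ge0 _) (nrm_ge0 _) (uK n) h2.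
have : e = K * d + d * nrm b + d by rewrite -dE; ring.
by clearbody d; lra.
Qed.

(** With [x = 1 - a], the fixed point [s] of [s |-> (x + s ^ 2) / 2] satisfies
    [(1 - s) ^ 2 = a]. *)
Fixpoint sqrt_iter (x : M) n : M :=
  if n is m.+1 then (2^-1)%:C *: (x + sqrt_iter x m * sqrt_iter x m) else 0.

(** The same iteration for the number [x = 1]; it increases to [1]. *)
Fixpoint sqrt_majorant n : R :=
  if n is m.+1 then 2^-1 * (1 + sqrt_majorant m * sqrt_majorant m) else 0.

Lemma sqrt_majorant_itv n : 0 <= sqrt_majorant n <= 1.
Proof.
elim: n => [|n /andP[]] /=; first by rewrite lexx ler01.
by set t := sqrt_majorant n => t0 t1; apply/andP; split; nra.
Qed.

(** Both steps are quadratic in the previous ones with nonnegative coefficients: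
    [2 (s'' - s') = s' (s' - s) + (s' - s) s], whence the domination. *)
Lemma sqrt_iter_bound (x : M) n : nrm x <= 1 ->
  nrm (sqrt_iter x n) <= sqrt_majorant n /\
  nrm (sqrt_iter x n.+1 - sqrt_iter x n) <= sqrt_majorant n.+1 - sqrt_majorant n.
Proof.
move=> x1; have half : `|2^-1 : R| = 2^-1 by rewrite ger0_norm// invr_ge0.
elim: n => [|n [IH1 IH2]].
  rewrite /= nrm0 lexx; split=> //.
  by rewrite !mulr0 !addr0 !subr0 nrmZ half ler_wpM2l// invr_ge0.
have [t0 t1] := andP (sqrt_majorant_itv n).
have h : nrm (sqrt_iter x n.+1) <= sqrt_majorant n.+1.
  rewrite /= nrmZ half ler_wpM2l ?invr_ge0//.
  apply: le_trans (nrmD _ _) _; rewrite lerD//.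
  by apply: le_trans (op_nrmM _ _) _; rewrite ler_pM ?nrm_ge0.
split=> //.
set s := sqrt_iter x n in IH1 IH2 *; set s' := sqrt_iter x n.+1 in IH2 h *.
set t := sqrt_majorant n in IH1 IH2 t0 t1 *.
set t' := sqrt_majorant n.+1 in IH2 h *.
have -> : sqrt_iter x n.+2 - s' = (2^-1)%:C *: (s' * (s' - s) + (s' - s) * s).
  rewrite [sqrt_iter x n.+2]/= -/s' {2}/s' /= -/s -scalerBr.
  by rewrite opprD addrACA subrr add0r mulrBr mulrBl addrA subrK.
have -> : sqrt_majorant n.+2 - t' = 2^-1 * (t' * (t' - t) + (t' - t) * t).
  have tE : t' = 2^-1 * (1 + t * t) by [].
  have -> : sqrt_majorant n.+2 = 2^-1 * (1 + t' * t') by [].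
  by rewrite [X in _ - X = _]tE; ring.
rewrite nrmZ half ler_wpM2l ?invr_ge0//.
apply: le_trans (nrmD _ _) _; rewrite lerD//.
  by apply: le_trans (op_nrmM _ _) _; rewrite ler_pM ?nrm_ge0.
by apply: le_trans (op_nrmM _ _) _; rewrite ler_pM ?nrm_ge0.
Qed.

Definition psd a := forall x, 0 <= rip (a x) x.

Lemma sqrt_iter_rsa_comm (x c : M) n : rsa x -> GRing.comm x c ->
  rsa (sqrt_iter x n) /\ GRing.comm (sqrt_iter x n) c.
Proof.
move=> rx xc; elim: n => [|n [IH1 IH2]] /=.
  by split; [exact: rsa0|exact/commr_sym/commr0].
split; first by apply/rsaZ/rsaD => //; exact: rsaM.
have h : GRing.comm c (x + sqrt_iter x n * sqrt_iter x n).
  by apply: commrD; [exact/commr_sym|apply: commrM; exact/commr_sym].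
by rewrite /GRing.comm -vn_scaleAl -vn_scaleAr -h.
Qed.

(** The limit [s] of the iteration has norm at most [1], so [1 - s >= 0]. *)
Lemma op_sqrt a : rsa a -> nrm (1 - a) <= 1 ->
  exists k, [/\ rsa k, psd k, k * k = a
    & forall c, GRing.comm a c -> GRing.comm k c].
Proof.
move=> ra; set x := 1 - a => x1.
have rx : rsa x by apply: rsaB.
have sc : cauchy_seq (sqrt_iter x).
  apply: (majorant_cauchy (c := fun n => 1 - sqrt_majorant n)) => n.
  - have [t0 t1] := andP (sqrt_majorant_itv n).
    by move=> /=; set t := sqrt_majorant n in t0 t1 *; nra.
  - by have := sqrt_majorant_itv n; rewrite subr_ge0 => /andP[].
  have [_ h] := sqrt_iter_bound n x1; apply: le_trans h _.
  by rewrite opprB [leRHS]addrC addrA subrK.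
have [s hs] := op_complete sc.
have s1 n : nrm (sqrt_iter x n) <= 1.
  have [h _] := sqrt_iter_bound n x1; apply: le_trans h _.
  by have /andP[] := sqrt_majorant_itv n.
have sE : s = (2^-1)%:C *: (x + s * s).
  apply: tends_uniq (tends_shift hs) _.
  exact: tendsZ (tendsD (tends_cst x) (tendsM s1 hs hs)).
have ssE : s + s = x + s * s.
  rewrite {1 2}sE -scalerDl -rmorphD/=.
  by rewrite (_ : 2^-1 + 2^-1 = 1 :> R) ?scale1r//; field.
exists (1 - s); split.
- apply: rsaB => //; apply: (@rsa_lim _ _ _ (sqrt_iter x)) => [n|y].
    by have [] := sqrt_iter_rsa_comm n rx (erefl (x * x)).
  exact: tends_app.
- move=> y; rewrite opB ripDl ripNl op1 ripxx subr_ge0.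
  apply: le_trans (rip_le _ _) _; rewrite expr2 ler_wpM2r ?nrm_ge0//.
  apply: le_trans (nrm_app _ _) _; rewrite ler_piMl ?nrm_ge0//.
  exact: tends_nrm_le hs s1.
- rewrite mulrBr mulr1 mulrBl mul1r.
  have -> : s * s = s + s - x by rewrite ssE addrAC subrr add0r.
  rewrite (opprB s) [s + s - x - s]addrAC addrK addrA subrK.
  by rewrite /x opprB addrC subrK.
- move=> c ac; apply/commr_sym/commrB; first exact: commr1.
  apply/commr_sym/(@tends_comm _ _ _ (sqrt_iter x)) => [n|y].
    have xc : GRing.comm x c.
      by apply/commr_sym/commrB; [exact: commr1|exact/commr_sym].
    by have [] := sqrt_iter_rsa_comm n rx xc.
  exact: tends_app.
Qed.

End SpectralCuts.

Section KernelProjections.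
Local Open Scope classical_set_scope.
Local Open Scope ring_scope.
Local Open Scope complex_scope.
Context {R : realType} {H : hilbert R} {M : vonNeumann H}.
Implicit Types (a b c e h : M) (x y z : H) (u : nat -> M).

Definition is_proj e := rsa e /\ e * e = e.

Lemma proj_app e x : is_proj e -> e (e x) = e x.
Proof. by move=> [_ ee]; rewrite -opM ee. Qed.

Lemma comm_scale (k : R[i]) a c : GRing.comm a c -> GRing.comm (k *: a) c.
Proof. by rewrite /GRing.comm -vn_scaleAl -vn_scaleAr => ->. Qed.

(** The strong limit of the powers of [a = 1 - b ^ 2]. With
    [c x n = <a ^ n x, x>], one has [c x n - c x (n + 1) = c (b x) n >= 0], so these
    sequences decrease, and [|a ^ m x - a ^ n x| ^ 2] is a combination of their
    terms of large index. *)
Lemma contraction_kernel_proj b : rsa b -> nrm b <= 1 ->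
  exists e, [/\ is_proj e, b * e = 0, forall x, b x = 0 -> e x = x
    & forall c, GRing.comm b c -> GRing.comm e c].
Proof.
move=> rb b1; pose a := 1 - b * b.
have ra : rsa a by apply: rsaB => //; exact: rsaM.
have ab : GRing.comm a b.
  by apply/commr_sym/commrB; [exact: commr1|exact: commrM].
have aE x : rip (a x) x = nrm x ^+ 2 - nrm (b x) ^+ 2.
  by rewrite opB ripDl ripNl op1 opM rb !ripxx.
have a0 : psd a.
  move=> x; rewrite aE subr_ge0 ler_pXn2r ?nnegrE ?nrm_ge0//.
  by apply: le_trans (nrm_app _ _) _; rewrite ler_piMl ?nrm_ge0.
have a1 : nrm a <= 1.
  apply: numerical_radius => // x.
  by rewrite ger0_norm// aE mul1r lerBlDr lerDl sqr_ge0.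
have an1 n : nrm (a ^+ n) <= 1.
  elim: n => [|n IH]; first exact: op_nrm1.
  rewrite exprS; apply: le_trans (op_nrmM _ _) _.
  by rewrite mulr_ile1 ?nrm_ge0.
pose c x n := rip ((a ^+ n) x) x.
have cD x m n : rip ((a ^+ m) x) ((a ^+ n) x) = c x (n + m)%N.
  by rewrite /c exprD opM (rsaX n ra).
have c0 x n : 0 <= c x n.
  (* [c x (2 j) = |a ^ j x| ^ 2], and [c x (2 j + 1)] is the form of [a] at
     [a ^ j x]. *)
  rewrite -(odd_double_half n) -addnn addnCA -cD addnC.
  case: (odd n); last by rewrite addn0 rip_ge0.
  by rewrite addn1 opS a0.
have cS x n : c x n.+1 <= c x n.
  have anb : b ((a ^+ n) x) = (a ^+ n) (b x).
    by rewrite -!opM (commrX n (commr_sym ab)).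
  have := c0 (b x) n; rewrite -[c x n.+1]/(rip ((a ^+ n.+1) x) x) opS opB.
  by rewrite ripDl ripNl op1 opM rb anb lerBlDr lerDl.
have ac x : cauchy_seq (fun n => (a ^+ n) x).
  move=> d d0.
  have d2 : 0 < d ^+ 2 / 2 by rewrite divr_gt0 ?exprn_gt0.
  have [N hN] := monotone_cauchy (cS x) (c0 x) d2.
  exists N => m n Nm Nn.
  rewrite -(ler_pXn2r (n := 2)) ?nnegrE ?nrm_ge0 ?(ltW d0)//.
  rewrite nrm_sqD nrmN ripNr -!ripxx !cD.
  have Na p q : (N <= p)%N -> (N <= p + q)%N.
    by move/leq_trans; apply; exact: leq_addr.
  have := hN _ _ (Na m m Nm) (Na n m Nn).
  have := hN _ _ (Na n n Nn) (Na n m Nn).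
  rewrite !ler_norml => /andP[_ h1] /andP[_ h2]; lra.
have [e he] := strong_limit an1 ac.
have be x : b (e x) = 0.
  apply: nrm0_eq0; apply/eqP; rewrite -sqrf_eq0 -ripxx -rb.
  have aeE : a (e x) = e x.
    apply: tends_uniq (tends_shift (he x)).
    have := tends_bounded (vn_val a) (he x).
    by congr (tends _ _); apply/funext => n; rewrite opS.
  have : a (e x) - e x = - b (b (e x)).
    by rewrite opB op1 opM addrAC subrr add0r.
  rewrite aeE subrr => /esym/eqP; rewrite oppr_eq0 => /eqP ->.
  by rewrite rip0l.
have ek x : b x = 0 -> e x = x.
  move=> bx; apply: tends_uniq (he x) _.
  have -> : (fun n => (a ^+ n) x) = (fun=> x); last exact: tends_cst.
  apply/funext; elim=> [//|n IH]; rewrite opS IH opB op1 opM bx.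
  by rewrite linear0 subr0.
exists e; split=> //.
- split; last by apply: op_ext => x; rewrite opM ek.
  by apply: rsa_lim he => n; exact: rsaX.
- by apply: op_ext => x; rewrite opM be.
- move=> d bd; apply: tends_comm he => n; apply/commr_sym/commrX/commrB.
    exact: commr1.
  by apply: commrM; exact: commr_sym.
Qed.

Lemma kernel_proj b : rsa b ->
  exists e, [/\ is_proj e, b * e = 0, forall x, b x = 0 -> e x = x
    & forall c, GRing.comm b c -> GRing.comm e c].
Proof.
move=> rb; have b0 := nrm_ge0 b; pose k := (nrm b + 1)^-1.
have k0 : 0 < k by rewrite invr_gt0; lra.
have [||e [pe be ek ec]] := @contraction_kernel_proj (k%:C *: b).
- exact: rsaZ.
- by rewrite nrmZ gtr0_norm// mulrC ler_pdivrMr; lra.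
exists e; split=> //.
- have kU : k%:C != 0 :> R[i] by rewrite fmorph_eq0 gt_eqF.
  by rewrite -[b * e](scalerK kU) vn_scaleAl be scaler0.
- by move=> x bx; apply: ek; rewrite opZ bx scaler0.
- by move=> c bc; apply: ec; exact: comm_scale.
Qed.

(** With [y = h - t], the kernel of [|y| + y] is the spectral subspace where
    [h <= t]: there [y = - |y|], and since [(|y| + y) (|y| - y) = 0] the
    orthogonal complement is killed by [|y| - y]. *)
Lemma spectral_cut h (t : R) : rsa h ->
  exists e, [/\ is_proj e, forall c, GRing.comm h c -> GRing.comm e c,
    forall x, e x = x -> rip (h x) x <= t * nrm x ^+ 2
    & forall x, e x = 0 -> t * nrm x ^+ 2 <= rip (h x) x].
Proof.
move=> rh; pose y0 := h - t%:C *: (1 : M).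
have n0 := nrm_ge0 y0; pose k := (nrm y0 + 1)^-1.
have k0 : 0 < k by rewrite invr_gt0; lra.
pose y := k%:C *: y0.
have ry : rsa y by apply/rsaZ/rsaB => //; exact/rsaZ.
have y1 : nrm y <= 1 by rewrite nrmZ gtr0_norm// mulrC ler_pdivrMr; lra.
have yE x : rip (y x) x = k * (rip (h x) x - t * nrm x ^+ 2).
  by rewrite opZ ripZl opB ripDl ripNl opZ ripZl op1 ripxx.
have hy c : GRing.comm h c -> GRing.comm y c.
  move=> hc; apply/comm_scale/commr_sym/commrB; first exact/commr_sym.
  exact/commr_sym/comm_scale/commr_sym/commr1.
have ryy : rsa (y * y) by exact: rsaM.
have yy1 : nrm (1 - y * y) <= 1.
  apply: numerical_radius => [||x]; [exact: rsaB|by []|].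
  have -> : rip ((1 - y * y) x) x = nrm x ^+ 2 - nrm (y x) ^+ 2.
    by rewrite opB ripDl ripNl op1 opM ry !ripxx.
  have : nrm (y x) ^+ 2 <= nrm x ^+ 2.
    rewrite ler_pXn2r ?nnegrE ?nrm_ge0//.
    by apply: le_trans (nrm_app _ _) _; rewrite ler_piMl ?nrm_ge0.
  have := sqr_ge0 (nrm (y x)).
  by rewrite ler_norml => *; apply/andP; split; lra.
have [v [rv pv vv vc]] := op_sqrt ryy yy1.
have vcom c : GRing.comm y c -> GRing.comm v c.
  by move=> yc; apply: vc; apply/commr_sym/commrM; exact/commr_sym.
have vy : GRing.comm v y by exact: vcom.
have rb : rsa (v + y) by exact: rsaD.
have [e [pe be ek ec]] := kernel_proj rb.
have ecom c : GRing.comm y c -> GRing.comm e c.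
  move=> yc; apply: ec; apply/commr_sym/commrD; apply/commr_sym => //.
  exact: vcom.
have ebot x : e (v x - y x) = v x - y x.
  have vvx : v (v x) = y (y x) by rewrite -!opM vv.
  have vyx : v (y x) = y (v x) by rewrite -!opM vy.
  by apply: ek; rewrite opD !linearB/= vvx vyx addrA subrK subrr.
exists e; split=> // [c hc|x ex|x ex].
- exact/ecom/hy.
- have : rip (y x) x <= 0.
    have : (v + y) x = 0 by rewrite -ex -opM be.
    rewrite opD addrC => /eqP; rewrite addr_eq0 => /eqP ->.
    by rewrite ripNl oppr_le0.
  by rewrite yE pmulr_rle0// subr_le0.
- have : 0 <= rip (y x) x.
    have /eqP : v x - y x = 0.
      have h1 : GRing.comm e (v - y).
        by apply: commrB; [apply/ecom/commr_sym|exact: ecom].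
      rewrite -ebot -[LHS]/((e * (v - y)) x) h1 opM ex linear0//.
    by rewrite subr_eq0 => /eqP <-.
  by rewrite yE pmulr_rge0// subr_ge0.
Qed.

End KernelProjections.

(** * Local maps and the bottom of the spectrum *)

Section NullCompression.
Local Open Scope classical_set_scope.
Local Open Scope ring_scope.
Local Open Scope complex_scope.
Context {R : realType} {H : hilbert R} {M : vonNeumann H}.
Implicit Types (a b c e h p : M) (x y z : H) (u : nat -> M).

Lemma proj_nrm p x : is_proj p -> nrm (p x) <= nrm x.
Proof.
move=> pp; have [->|x0] := eqVneq (p x) 0; first by rewrite nrm0 nrm_ge0.
rewrite -(ler_pM2r (nrm_gt0 x0)) -expr2 -ripxx.
by case: (pp) => rp _; rewrite -rp proj_app// mulrC rip_le.
Qed.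

(** The quadratic form of [h] is nonnegative at [x + s (h x)] for real [s]. *)
Lemma psd_null h x : rsa h -> psd h -> rip (h x) x = 0 -> h x = 0.
Proof.
move=> rh ph hx; apply: nrm0_eq0; apply/eqP; rewrite -sqrf_eq0.
pose A := nrm (h x) ^+ 2; pose C := rip (h (h x)) (h x).
have A0 : 0 <= A by exact: sqr_ge0.
have C0 : 0 <= C by exact: ph.
have q (s : R) : 0 <= 2 * s * A + s ^+ 2 * C.
  have := ph (x + s%:C *: h x).
  rewrite linearD linearZ/= !(ripDl, ripDr, ripZl, ripZr) hx.
  rewrite (rh (h x) x) ripxx -/A -/C.
  by congr (_ <= _); ring.
(* [C + 1] in place of [C], which may vanish. *)
have := q (- (A / (C + 1))).
have D0 : 0 < C + 1 by lra.
have -> : 2 * - (A / (C + 1)) * A + (- (A / (C + 1))) ^+ 2 * C =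
    - (A ^+ 2 * (C + 2)) / (C + 1) ^+ 2 by field; rewrite gt_eqF.
rewrite pmulr_lge0 ?invr_gt0 ?exprn_gt0// => h1.
have : A ^+ 2 * 2 <= A ^+ 2 * (C + 2) by rewrite ler_wpM2l ?sqr_ge0//; lra.
have := sqr_ge0 A; rewrite -/A -sqrf_eq0 eq_le => A2 h2.
by rewrite A2 andbT; lra.
Qed.

(** Locality: the compression of [T a] to the range of [p] depends only on the
    corner of [a] at [p], provided that [a] commutes with [p]. *)
Definition null_compression (T : M -> M) :=
  forall p a, is_proj p -> p * a = 0 -> a * p = 0 -> p * T a * p = 0.

Lemma null_compression_rip (T : {linear M -> M}) p a b x :
  null_compression T -> is_proj p ->
  p * a = p * b -> a * p = b * p -> p x = x ->
  rip (T a x) x = rip (T b x) x.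
Proof.
move=> LT pp pab abp px; have [rp _] := pp.
have := LT p (a - b) pp.
rewrite mulrBr mulrBl pab abp !subrr => /(_ erefl erefl) h.
apply/eqP; rewrite -subr_eq0 -ripNl -ripDl -opB -linearB/=.
have <- : rip ((p * T (a - b) * p) x) x = rip (T (a - b) x) x.
  by rewrite !opM rp !px.
by rewrite h op0 rip0l.
Qed.

(** [k] is the sum of the [2 ^ n h q_n], which converges in norm because [h q_n]
    has norm at most [4 ^ - n]. *)
Lemma amplified_sum h (q : nat -> M) : rsa h -> psd h ->
  (forall n, is_proj (q n)) -> (forall n, GRing.comm (q n) h) ->
  (forall m n, m != n -> q m * q n = 0) ->
  (forall n x, q n x = x -> rip (h x) x <= 4^-1 ^+ n * nrm x ^+ 2) ->
  exists k, forall n, k * q n = (2 ^+ n)%:C *: h * q n /\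
                      q n * k = q n * ((2 ^+ n)%:C *: h).
Proof.
move=> rh ph pq qh qq hq.
have q4 n : 0 <= 4^-1 ^+ n :> R by rewrite exprn_ge0// invr_ge0.
have nq n : nrm (h * q n) <= 4^-1 ^+ n.
  have [rq qqn] := pq n.
  apply: numerical_radius => // [|x].
    by apply: rsaM => //; exact/commr_sym.
  have -> : rip ((h * q n) x) x = rip (h (q n x)) (q n x).
    by rewrite -rq -!opM qh -mulrA qqn.
  rewrite ger0_norm//; apply: le_trans (hq _ _ (proj_app x (pq n))) _.
  by rewrite ler_wpM2l// ler_pXn2r ?nnegrE ?nrm_ge0// proj_nrm.
pose k := fix k n := if n is m.+1 then k m + (2 ^+ m)%:C *: (h * q m) else 0.
have [] := @op_complete _ _ _ k _.
  apply: geometric_cauchy => n; rewrite /= addrC addKr nrmZ.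
  rewrite ger0_norm ?exprn_ge0//.
  have -> : 2^-1 ^+ n = 2 ^+ n * 4^-1 ^+ n :> R.
    by rewrite -exprMn; congr (_ ^+ _); field.
  by rewrite ler_wpM2l ?exprn_ge0.
move=> s ks; exists s => n.
have kq m : GRing.comm (k m) (q n).
  elim: m => [|m IH] /=; first exact/commr_sym/commr0.
  apply/commr_sym/commrD; first exact/commr_sym.
  apply/commr_sym/comm_scale/commr_sym/commrM; first exact: qh.
  have [->|/[dup] nm /qq e1] := eqVneq n m; first by [].
  by rewrite /GRing.comm e1 qq// eq_sym.
have kmq m : (n < m)%N -> k m * q n = (2 ^+ n)%:C *: h * q n.
  have k0 i : (i <= n)%N -> k i * q n = 0.
    elim: i => [|i IH] lin /=; first by rewrite mul0r.
    rewrite mulrDl IH 1?ltnW// add0r -vn_scaleAl -mulrA qq ?mulr0 ?scaler0//.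
    by rewrite ltn_eqF.
  elim: m => // m IH; rewrite ltnS leq_eqVlt => /orP[/eqP <-|nm] /=.
    by rewrite mulrDl k0// add0r -!vn_scaleAl -mulrA; have [_ ->] := pq n.
  rewrite mulrDl IH// -[X in _ + X]vn_scaleAl -mulrA.
  rewrite qq ?mulr0 ?scaler0 ?addr0//.
  by rewrite gtn_eqF.
have sq : s * q n = (2 ^+ n)%:C *: h * q n.
  apply: op_ext => x; rewrite opM.
  have lesum m : (m <= n.+1 + m)%N by exact: leq_addl.
  apply: tends_uniq (tends_sub lesum (tends_app (q n x) ks)) _.
  rewrite -(_ : (fun=> ((2 ^+ n)%:C *: h * q n) x) =
              (fun m => k (n.+1 + m)%N (q n x))); first exact: tends_cst.
  by apply/funext => m; rewrite -opM kmq// leq_addr.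
split=> //; have <- : GRing.comm s (q n).
  by apply: tends_comm kq _ => x; exact: tends_app.
by rewrite sq -vn_scaleAl -vn_scaleAr qh.
Qed.

End NullCompression.

Section Core.
Local Open Scope classical_set_scope.
Local Open Scope ring_scope.
Local Open Scope complex_scope.
Context {R : realType} {H : hilbert R} {M : vonNeumann H}.
Implicit Types (a b c e h p : M) (x y z : H) (u : nat -> M).

(** Differences of spectral projections [p (t n) - p (t (n + 1))] along levels
    [t n] decreasing fast to [0]. As [h] is injective with infimum [0], no [p t]
    with [t > 0] is zero, and every nonzero vector leaves the range of [p s] for
    [s] small; so the next level can be chosen to make the difference nonzero. *)
Lemma bottom_spectral_pieces h (d : R) : rsa h -> psd h -> 0 < d ->
  (forall x, h x = 0 -> x = 0) ->
  (forall d, 0 < d -> exists2 x, x != 0 & rip (h x) x <= d * nrm x ^+ 2) ->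
  exists q : nat -> M,
    [/\ forall n, is_proj (q n), forall n, GRing.comm (q n) h,
        forall m n, m != n -> q m * q n = 0,
        forall n x, q n x = x -> rip (h x) x <= d * 4^-1 ^+ n * nrm x ^+ 2
      & forall n, exists2 x, x != 0 & q n x = x].
Proof.
move=> rh ph d0 hker hinf.
have hpos x : x != 0 -> 0 < rip (h x) x.
  move=> x0; rewrite lt_neqAle ph andbT eq_sym.
  by apply: contra x0 => /eqP/(psd_null rh ph)/hker ->.
pose p (t : R) := projT1 (cid (spectral_cut t rh)).
have pP t : [/\ is_proj (p t), forall c, GRing.comm h c -> GRing.comm (p t) c,
    forall x, p t x = x -> rip (h x) x <= t * nrm x ^+ 2
    & forall x, p t x = 0 -> t * nrm x ^+ 2 <= rip (h x) x].
  by rewrite /p; case: cid.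
have pp t : is_proj (p t) by case: (pP t).
have pc t c : GRing.comm h c -> GRing.comm (p t) c.
  by case: (pP t) => _ + _ _; apply.
have ple t x : p t x = x -> rip (h x) x <= t * nrm x ^+ 2.
  by case: (pP t) => _ _ + _; apply.
have pge t x : p t x = 0 -> t * nrm x ^+ 2 <= rip (h x) x.
  by case: (pP t) => _ _ _; apply.
have ph_comm t : GRing.comm (p t) h by exact: pc.
have ppC s t : GRing.comm (p s) (p t) by apply/pc/commr_sym.
have nest s t : s < t -> p t * p s = p s.
  move=> st; apply: op_ext => x; rewrite opM.
  pose z := p s x - p t (p s x).
  have z1 : p s z = z.
    rewrite /z linearB/= (proj_app _ (pp s)) -(opM (p s)) ppC opM.
    by rewrite (proj_app _ (pp s)).
  have z2 : p t z = 0 by rewrite /z linearB/= (proj_app _ (pp t)) subrr.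
  have := ple _ _ z1; have := pge _ _ z2 => h1 /(le_trans h1).
  have [z0|z0] := eqVneq z 0; first by move: z0 => /subr0_eq.
  rewrite ler_pM2r ?exprn_gt0 ?nrm_gt0//.
  by rewrite leNgt st.
pose good (t s : R) :=
  s <= t / 4 /\ exists x, [/\ x != 0, p t x = x & p s x = 0].
have step t : 0 < t -> exists2 s, 0 < s & good t s.
  move=> t0.
  have [z z0 hz] := hinf (t / 2) ltac:(lra).
  have w0 : p t z != 0.
    apply/eqP => /pge/le_trans/(_ hz).
    by rewrite ler_pM2r ?exprn_gt0 ?nrm_gt0//; lra.
  set w := p t z in w0.
  have pw : p t w = w by exact: proj_app.
  have w2 : 0 < nrm w ^+ 2 by rewrite exprn_gt0 ?nrm_gt0.
  pose r := rip (h w) w / nrm w ^+ 2.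
  have r0 : 0 < r by rewrite divr_gt0 ?hpos.
  have rE : rip (h w) w = r * nrm w ^+ 2 by rewrite divfK// gt_eqF.
  (* Below its mean [r] at [w], the spectral subspace no longer contains [w]. *)
  pose s := Num.min (t / 4) (r / 2).
  have s0 : 0 < s by rewrite lt_min; apply/andP; split; lra.
  have st : s <= t / 4 by rewrite ge_min lexx.
  have sr : s <= r / 2 by rewrite ge_min lexx orbT.
  exists s => //; split=> //; exists (w - p s w).
  have st' : s < t by lra.
  split.
  - apply/eqP => /subr0_eq /esym /ple; rewrite rE ler_pM2r//; lra.
  - by rewrite linearB/= pw -opM nest.
  - by rewrite linearB/= (proj_app _ (pp s)) subrr.
have [t [t0 tn]] : exists t : nat -> R,
    t 0%N <= d /\ forall n, 0 < t n /\ good (t n) (t n.+1).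
  have [] := @dependent_choice_on R (fun n t => 0 < t /\ (n = 0%N -> t <= d))
    (fun _ => good) d.
  - by split.
  - move=> n t [t0 _]; have [s s0 gs] := step t t0.
    by exists s.
  move=> t tP; exists t; split; first by have [[_ /(_ erefl)]] := tP 0%N.
  by move=> n; have [[]] := tP n.
have tpos n : 0 < t n by case: (tn n).
have tS n : t n.+1 <= t n / 4 by case: (tn n) => _ [].
have tmono m n : (m < n)%N -> t n < t m.
  elim: n => // n IH; rewrite ltnS leq_eqVlt => /orP[/eqP ->|/IH];
    have := tS n; have := tpos n; lra.
have t4 n : t n <= d * 4^-1 ^+ n.
  elim: n => [|n IH]; first by rewrite expr0 mulr1.
  by rewrite exprS; have := tS n; lra.
pose q n := p (t n) - p (t n.+1).
have nest1 n : p (t n) * p (t n.+1) = p (t n.+1) by apply: nest; exact: tmono.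
have nest2 n : p (t n.+1) * p (t n) = p (t n.+1) by rewrite ppC nest1.
have idem n : p (t n) * p (t n) = p (t n) by case: (pp (t n)).
have pq n : p (t n) * q n = q n by rewrite mulrBr idem nest1.
have pq0 n : p (t n.+1) * q n = 0 by rewrite mulrBr idem nest2 subrr.
have qp n s : GRing.comm (q n) (p s).
  by apply/commr_sym/commrB; exact: ppC.
exists q; split.
- move=> n; split.
    by apply: rsaB; [case: (pp (t n))|case: (pp (t n.+1))].
  by rewrite {1}/q mulrBl pq pq0 subr0.
- by move=> n; apply/commr_sym/commrB; exact/commr_sym.
- have lt m n : (m < n)%N -> q n * q m = 0.
    move=> mn; rewrite -(pq n) (_ : p (t n) = p (t n) * p (t m.+1)); last first.
      move: mn; rewrite leq_eqVlt => /orP[/eqP ->|/tmono/nest e1].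
        by rewrite idem.
      by rewrite ppC e1.
    rewrite -(mulrA (p (t n))) -(qp n) -!mulrA.
    by rewrite pq0 !mulr0.
  move=> m n; rewrite neq_ltn => /orP[/lt e1|/lt //].
  have -> : q m * q n = q n * q m.
    by apply: commrB; exact: qp.
  by [].
- move=> n x qx; have px : p (t n) x = x by rewrite -qx -opM pq.
  apply: le_trans (ple _ _ px) _.
  by rewrite ler_wpM2r ?sqr_ge0.
- move=> n; have [_ [_ [x [x0 px px0]]]] := tn n.
  by exists x => //; rewrite opB px px0 subr0.
Qed.

(** If [h x = 0] with [x <> 0], the kernel projection [e] of [h] gives
    [e (T h) e = 0] and [x] will do. If [h] is injective and the conclusion fails,
    then [|<T h x, x>| > d |x| ^ 2] for [x] in the range of any of the spectral
    pieces [q n]; the element [k] of [amplified_sum] has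
    [<T k x, x> = 2 ^ n <T h x, x>] there, which contradicts the boundedness of
    [T k]. *)
Lemma small_compression (T : {linear M -> M}) h (d : R) :
  null_compression T -> rsa h -> psd h -> 0 < d ->
  (forall d, 0 < d -> exists2 x, x != 0 & rip (h x) x <= d * nrm x ^+ 2) ->
  exists x, [/\ x != 0, rip (h x) x <= d * nrm x ^+ 2
    & `|rip (T h x) x| <= d * nrm x ^+ 2].
Proof.
move=> LT rh ph d0 hinf; apply: contrapT => nex.
have big x : x != 0 -> rip (h x) x <= d * nrm x ^+ 2 ->
    d * nrm x ^+ 2 < `|rip (T h x) x|.
  by move=> x0 hx; rewrite ltNge; apply/negP => Tx; apply: nex; exists x.
have hker x : h x = 0 -> x = 0.
  move=> hx; apply: contrapT => /eqP x0.
  have [e [pe he ek ec]] := kernel_proj rh.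
  have := big x x0; rewrite hx rip0l => /(_ (mulr_ge0 (ltW d0) (sqr_ge0 _))).
  rewrite (null_compression_rip (b := 0) LT pe _ _ (ek x hx)).
  - by rewrite linear0 op0 rip0l normr0 ltNge mulr_ge0 ?sqr_ge0// ltW.
  - by rewrite (ec h erefl) he mulr0.
  - by rewrite he mul0r.
(* At most [d], for the failure of the claim to apply, and at most [1], for the
   norm bounds [4 ^ - n]. *)
pose d' := Num.min d 1.
have d'0 : 0 < d' by rewrite lt_min d0 ltr01.
have [q [qp qh qq hq qx]] := bottom_spectral_pieces rh ph d'0 hker hinf.
have q4 n : 0 < 4^-1 ^+ n :> R by rewrite exprn_gt0// invr_gt0.
have [] := @amplified_sum _ _ _ h q rh ph qp qh qq.
  move=> n x /hq/le_trans; apply; rewrite ler_wpM2r ?sqr_ge0//.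
  by rewrite ler_piMl ?(ltW (q4 n))// ge_min lexx orbT.
move=> k kq.
have [n] := expr2_unbounded (nrm (T k) / d).
rewrite ltr_pdivrMr// => kn.
have [x x0 qnx] := qx n.
have x2 : 0 < nrm x ^+ 2 by rewrite exprn_gt0 ?nrm_gt0.
have [kq1 kq2] := kq n.
have Tk : rip (T k x) x = 2 ^+ n * rip (T h x) x.
  rewrite (null_compression_rip LT (qp n) kq2 kq1 qnx).
  by rewrite linearZ/= ripZl.
have hx : rip (h x) x <= d * nrm x ^+ 2.
  apply: le_trans (hq _ _ qnx) _; rewrite ler_wpM2r ?(ltW x2)//.
  rewrite -[leRHS]mulr1 ler_pM ?(ltW d'0) ?(ltW (q4 n))// ?ge_min ?lexx//.
  by rewrite exprn_ile1// ?invr_ge0// invf_le1 ?ler1n.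
have := big x x0 hx.
rewrite -(ltr_pM2l (exprn_gt0 n (ltr0Sn R 1))) => h1.
have : `|rip (T k x) x| <= nrm (T k) * nrm x ^+ 2.
  apply: le_trans (rip_CS _ _) _; rewrite expr2 mulrA ler_wpM2r ?nrm_ge0//.
  exact: nrm_app.
rewrite Tk normrM ger0_norm ?exprn_ge0// => /(lt_le_trans h1).
by rewrite mulrA ltr_pM2r// ltNge (ltW kn).
Qed.

End Core.

(** * Dissipativity and boundedness *)

Section Dissipation.
Local Open Scope classical_set_scope.
Local Open Scope ring_scope.
Local Open Scope complex_scope.
Context {R : realType} {H : hilbert R} {M : vonNeumann H}.
Implicit Types (a b c e h p : M) (y z : H) (u : nat -> M).

(** Twice the self-adjoint part of [T a]. The proof of boundedness iterates the
    map, so it has to preserve the self-adjoint elements. *)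
Definition herm_part (T : M -> M) a : M := T a + star (T a).

Lemma rsa_herm_part T a : rsa (herm_part T a).
Proof. by apply: star_rsa; rewrite /herm_part starD starK addrC. Qed.

(** For [a] self-adjoint: the maximum of the spectrum of [a] is [|a|]. *)
Definition top_attained a :=
  forall d : R, 0 < d -> exists2 y, y != 0 &
    (nrm a - d) * nrm y ^+ 2 <= rip (a y) y.

Lemma top_attained_or a : rsa a -> a != 0 ->
  top_attained a \/ top_attained (- a).
Proof.
move=> ra a0; have na := nrm_gt0 a0.
apply: contrapT => /not_orP[/existsNP[d1 /not_implyP[d10 h1]]].
move=> /existsNP[d2 /not_implyP[d20 h2]].
pose d := Num.min (nrm a) (Num.min d1 d2).
have d0 : 0 < d by rewrite !lt_min na d10.
have da : d <= nrm a by rewrite ge_min lexx.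
have dd1 : d <= d1 by rewrite !ge_min lexx orbT.
have dd2 : d <= d2 by rewrite !ge_min lexx !orbT.
clearbody d.
suff : nrm a <= nrm a - d by rewrite lerBrDr gerDl leNgt d0.
apply: numerical_radius => // [|y]; first by rewrite subr_ge0.
have [->|y0] := eqVneq y 0.
  by rewrite linear0 rip0l nrm0 expr0n mulr0 normr0.
have y2 : 0 < nrm y ^+ 2 by rewrite exprn_gt0 ?nrm_gt0.
have {}h1 : rip (a y) y < (nrm a - d1) * nrm y ^+ 2.
  by rewrite ltNge; apply/negP => hy; apply: h1; exists y.
have {}h2 : rip ((- a) y) y < (nrm a - d2) * nrm y ^+ 2.
  by rewrite ltNge; apply/negP => hy; apply: h2; exists y => //; rewrite nrmN.
rewrite opN ripNl in h2.
have m1 : (nrm a - d1) * nrm y ^+ 2 <= (nrm a - d) * nrm y ^+ 2.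
  by rewrite ler_pM2r// lerB.
have m2 : (nrm a - d2) * nrm y ^+ 2 <= (nrm a - d) * nrm y ^+ 2.
  by rewrite ler_pM2r// lerB.
by rewrite ler_norml lerNl (le_trans (ltW h2) m2) (le_trans (ltW h1) m1).
Qed.

(** The infimum of the spectrum of [h = |a| - a] is zero. At the vector [y] of
    [small_compression], [<a y, y>] is almost [|a| |y| ^ 2] and [<T a y, y>] is
    almost [|a| <T 1 y, y>], which bounds [<(a - l S a) y, y>] from below. *)
Lemma dissipative_top (T : {linear M -> M}) a (l : R) :
  null_compression T -> rsa a -> 0 <= l -> top_attained a ->
  nrm a <= nrm (a - l%:C *: herm_part T a) + l * (2 * nrm (T 1)) * nrm a.
Proof.
move=> LT ra l0 ta; set C := nrm (T 1); set n := nrm a.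
apply/ler_addgt0Pl => e0 e00.
(* The total error made below is [d] for [<a y, y>] and [2 l d] for the term
   with [S], relative to [|y| ^ 2]. *)
pose d := e0 / (1 + 2 * l).
have dE : d * (1 + 2 * l) = e0 by rewrite divfK// gt_eqF//; lra.
have d0 : 0 < d by apply: divr_gt0 => //; lra.
pose h := n%:C *: (1 : M) - a.
have hE y : rip (h y) y = n * nrm y ^+ 2 - rip (a y) y.
  by rewrite opB ripDl ripNl opZ ripZl op1 ripxx.
have rh : rsa h by apply: rsaB => //; exact/rsaZ.
have ph : psd h.
  move=> y; rewrite hE subr_ge0; apply: le_trans (rip_le _ _) _.
  by rewrite expr2 mulrA ler_wpM2r ?nrm_ge0// nrm_app.
have [|y [y0 hy Ty]] := small_compression LT rh ph d0.
  move=> d1 d10; have [y y0 hy] := ta d1 d10; exists y => //.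
  by rewrite hE; rewrite mulrBl in hy; lra.
have y2 : 0 < nrm y ^+ 2 by rewrite exprn_gt0 ?nrm_gt0.
have T1 : rip (T 1 y) y <= C * nrm y ^+ 2.
  apply: le_trans (rip_le _ _) _.
  by rewrite expr2 mulrA ler_wpM2r ?nrm_ge0// nrm_app.
have ThE : rip (T h y) y = n * rip (T 1 y) y - rip (T a y) y.
  by rewrite linearB linearZ/= ripDl ripNl ripZl.
rewrite ThE ler_norml in Ty; have {Ty} /andP[Ty _] := Ty.
set v := a - _.
have vE : rip (v y) y = rip (a y) y - l * (2 * rip (T a y) y).
  rewrite opB ripDl ripNl opZ ripZl opD ripDl.
  by rewrite [rip (star _ _) _]ripC -rip_star; ring.
have vn : rip (v y) y <= nrm v * nrm y ^+ 2.
  apply: le_trans (rip_le _ _) _.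
  by rewrite expr2 mulrA ler_wpM2r ?nrm_ge0// nrm_app.
rewrite hE in hy.
have n0 : 0 <= n by exact: nrm_ge0.
have h1 := ler_wpM2l n0 T1.
have h2 : rip (T a y) y <= (n * C + d) * nrm y ^+ 2 by lra.
have h3 := ler_wpM2l l0 h2.
rewrite -(ler_pM2r y2) -dE.
move: vE vn hy h3; set A := rip (a y) y; set B := rip (T a y) y => -> *.
lra.
Qed.

Lemma dissipative (T : {linear M -> M}) a (l : R) :
  null_compression T -> rsa a -> 0 <= l ->
  nrm a <= nrm (a - l%:C *: herm_part T a) + l * (2 * nrm (T 1)) * nrm a.
Proof.
move=> LT ra l0; have [->|a0] := eqVneq a 0.
  by rewrite nrm0 mulr0 addr0 nrm_ge0.
have [ta|ta] := top_attained_or ra a0; first exact: dissipative_top.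
have := dissipative_top LT (rsaN ra) l0 ta.
have -> : herm_part T (- a) = - herm_part T a.
  by rewrite /herm_part linearN/= starN opprD.
by rewrite scalerN opprK nrmN [- a + _]addrC -(opprB a) nrmN.
Qed.

End Dissipation.

Section AutomaticContinuity.
Local Open Scope classical_set_scope.
Local Open Scope ring_scope.
Local Open Scope complex_scope.
Context {R : realType} {H : hilbert R} {M : vonNeumann H}.
Implicit Types (a b c e h p x : M) (u : nat -> M).

(** Were [S] unbounded, there would be a convergent sequence [s n], with limit [x],
    such that [S (s n)] has norm at least [n], and with remainders [r = x - s n] as
    small as desired compared with [s n]. Put [b = S r]. In the estimate at
    [r + l b] the terms [l b] cancel:
    [|r + l b| <= |r - l ^ 2 S b| + l C |r + l b|], where
    [S b = S (S x) - S (S (s n))]. With [|r| <= l ^ 2] and [l |S (S (s n))| <= 1],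
    division by [l] bounds [b = S x - S (s n)] independently of [n]. *)
Lemma dissipative_bounded (S : M -> M) (C : R) : 0 <= C ->
  {morph S : a b / a + b} -> (forall (k : R) a, S (k%:C *: a) = k%:C *: S a) ->
  (forall a, rsa (S a)) ->
  (forall a (l : R), rsa a -> 0 <= l ->
    nrm a <= nrm (a - l%:C *: S a) + l * C * nrm a) ->
  exists2 K : R, 0 <= K & forall a, rsa a -> nrm (S a) <= K * nrm a.
Proof.
move=> C0 SD SZ rS dis; apply: contrapT => nK.
have S0 : S 0 = 0 by have := SZ 0 0; rewrite !scale0r.
have SN a : S (- a) = - S a.
  by apply/eqP; rewrite -addr_eq0 -SD addNr S0.
have SB a b : S (a - b) = S a - S b by rewrite SD SN.
have large (d N : R) : 0 < d -> 0 <= N ->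
    exists z, [/\ rsa z, nrm z <= d & N <= nrm (S z)].
  move=> d0 N0; apply: contrapT => nz; apply: nK; exists (N / d).
    by rewrite divr_ge0// ltW.
  move=> a ra; rewrite leNgt; apply/negP => ha; apply: nz.
  have a0 : a != 0 by apply: contraTN ha => /eqP ->; rewrite S0 nrm0 mulr0 ltxx.
  have an := nrm_gt0 a0; have da : 0 < d / nrm a by rewrite divr_gt0.
  exists ((d / nrm a)%:C *: a); split; first exact: rsaZ.
    by rewrite nrmZ gtr0_norm// divfK// gt_eqF.
  rewrite SZ nrmZ gtr0_norm//; have := ler_wpM2l (ltW da) (ltW ha).
  by congr (_ <= _); field; rewrite !gt_eqF.
(* Chosen so that [l C <= 1/2], [l <= 1/2] and [l |S (S s)| <= 1]. *)
pose l s := (2 + 2 * C + nrm (S (S s)))^-1.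
have lden s : 0 < 2 + 2 * C + nrm (S (S s)) by have := nrm_ge0 (S (S s)); lra.
have l0 s : 0 < l s by rewrite invr_gt0.
(* A state is a partial sum together with a bound for all later changes. *)
pose P n (sd : M * R) :=
  [/\ rsa sd.1, 0 < sd.2, sd.2 <= l sd.1 ^+ 2 & n%:R <= nrm (S sd.1)].
pose Q (_ : nat) (sd td : M * R) :=
  nrm (td.1 - sd.1) <= sd.2 - td.2 /\ td.2 <= sd.2.
have P0 : P 0%N (0, l 0 ^+ 2).
  by split=> /=; [exact: rsa0|exact: exprn_gt0|by []|exact: nrm_ge0].
have step n sd : P n sd -> exists2 td, P n.+1 td & Q n sd td.
  case: sd => s d [/= rs d0 dl ns].
  have [||z [rz zd zS]] := large (d / 2) (n.+1%:R + nrm (S s)).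
  - by lra.
  - by rewrite addr_ge0 ?nrm_ge0.
  pose d1 := Num.min (d / 2) (l (s + z) ^+ 2).
  have d10 : 0 < d1 by rewrite lt_min exprn_gt0// andbT; lra.
  have d1l : d1 <= l (s + z) ^+ 2 by rewrite ge_min lexx orbT.
  have d1d : d1 <= d / 2 by rewrite ge_min lexx.
  clearbody d1; exists (s + z, d1); split=> //=.
  - exact: rsaD.
  - by rewrite SD; have := nrmB (S s + S z) (S s); rewrite addrC addKr; lra.
  - by rewrite addrC addKr; lra.
  - by lra.
have [f fP] := dependent_choice_on P0 step.
pose s n := (f n).1; pose d n := (f n).2.
have dS n : d n.+1 <= d n by have [_ []] := fP n.
have d0 n : 0 < d n by have [[]] := fP n.
have dl n : d n <= l (s n) ^+ 2 by have [[]] := fP n.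
have sS n : nrm (s n.+1 - s n) <= d n - d n.+1 by have [_ []] := fP n.
have rs n : rsa (s n) by have [[]] := fP n.
have nS n : n%:R <= nrm (S (s n)) by have [[]] := fP n.
have [x sx] := op_complete (majorant_cauchy dS (fun n => ltW (d0 n)) sS).
have rx : rsa x by apply: (rsa_lim rs) => y; exact: tends_app.
have rd n : nrm (x - s n) <= d n.
  apply: (tends_ball (N := n) sx) => m nm.
  by have := majorant_dist sS nm; have := d0 m; lra.
have bnd n : nrm (S (s n)) <= nrm (S x) + (5 + 2 * nrm (S (S x))).
  set r := x - s n; set b := S r; set k := l (s n).
  have k0 : 0 < k by exact: l0.
  have rk : nrm r <= k ^+ 2 by exact: le_trans (rd n) (dl n).
  have kE : k * (2 + 2 * C + nrm (S (S (s n)))) = 1 by rewrite mulVf// gt_eqF.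
  have Sb : nrm (S b) <= nrm (S (S x)) + nrm (S (S (s n))).
    by rewrite /b /r !SB nrmB.
  have rr : rsa r by exact: rsaB.
  have := dis (r + k%:C *: b) k (rsaD rr (rsaZ _ (rS r))) (ltW k0).
  rewrite SD SZ scalerDr opprD -/b addrA addrK.
  set w := nrm (r + _) => hw.
  have w0 : 0 <= w by exact: nrm_ge0.
  have h1 : k * nrm b <= w + k ^+ 2.
    have := nrmB (r + k%:C *: b) r; rewrite addrC addKr nrmZ gtr0_norm//.
    by rewrite -/w; lra.
  have h2 := nrmB r (k%:C *: (k%:C *: S b)).
  rewrite !nrmZ gtr0_norm// in h2.
  have kC : 0 <= k * C by rewrite mulr_ge0// ltW.
  have kY : 0 <= k * nrm (S (S (s n))) by rewrite mulr_ge0 ?nrm_ge0// ltW.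
  have kk : k <= 2^-1 by lra.
  have h3 : k * C * w <= 2^-1 * w by rewrite ler_wpM2r//; lra.
  have h4 : nrm b <= 3 * k + 2 * (k * nrm (S b)).
    by rewrite -(ler_pM2l k0); lra.
  have h5 := ler_wpM2l (ltW k0) Sb.
  have h6 := ler_wpM2r (nrm_ge0 (S (S x))) kk.
  have -> : S (s n) = S x - b by rewrite /b /r SB opprB addrC subrK.
  have := nrmB (S x) b; have := nrm_ge0 (S (S x)); lra.
have := archi_boundP (normr_ge0 (nrm (S x) + (5 + 2 * nrm (S (S x))))).
set N := Num.bound _; rewrite ltNge => /negP; apply.
by apply: le_trans (nS N) (le_trans (bnd N) (ler_norm _)).
Qed.

End AutomaticContinuity.

(** * Continuity *)

Section Continuity.
Local Open Scope classical_set_scope.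
Local Open Scope ring_scope.
Local Open Scope complex_scope.
Context {R : realType} {H : hilbert R} {M : vonNeumann H}.
Implicit Types (a b c e h p x : M) (u : nat -> M).

Lemma iZiZ (V : lmodType R[i]) (v : V) : 'i *: ('i *: v) = - v.
Proof.
rewrite scalerA -scaleN1r; congr (_ *: _).
by apply/eqP; rewrite eq_complex/=; apply/andP; split; apply/eqP; ring.
Qed.

Lemma half_double (V : lmodType R[i]) (v : V) : (2^-1)%:C *: (v + v) = v.
Proof.
rewrite scalerDr -scalerDl -rmorphD/=.
by rewrite (_ : 2^-1 + 2^-1 = 1 :> R) ?scale1r//; field.
Qed.

Lemma star_iZ a : star ('i *: a) = - ('i *: star a).
Proof.
apply: star_eq => y z; rewrite opN !opZ ripNr /rip linearZl_LR linearZr_LR/=.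
rewrite -[dot H y _]starP.
by case: (dot H _ _) => s t /=; ring.
Qed.

Lemma herm_part_bounded (T : {linear M -> M}) : null_compression T ->
  exists2 K : R, 0 <= K & forall a, rsa a -> nrm (herm_part T a) <= K * nrm a.
Proof.
move=> LT; apply: (@dissipative_bounded _ _ _ _ (2 * nrm (T 1))).
- by rewrite mulr_ge0// nrm_ge0.
- by move=> a b; rewrite /herm_part linearD starD addrACA.
- by move=> k a; rewrite /herm_part linearZ/= starZ scalerDr.
- exact: rsa_herm_part.
- by move=> a l ra l0; exact: dissipative.
Qed.

(** For self-adjoint [a], [2 T a = herm_part T a - i (herm_part (i T) a)]. *)
Lemma null_compression_continuous (T : {linear M -> M}) :
  null_compression T -> continuous T.
Proof.
move=> LT; pose T' : {linear M -> M} := 'i \*: T.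
have LT' : null_compression T'.
  move=> p a pp pa ap /=.
  by rewrite -vn_scaleAr -vn_scaleAl LT// scaler0.
have [K1 K10 h1] := herm_part_bounded LT.
have [K2 K20 h2] := herm_part_bounded LT'.
have Tsa a : rsa a -> nrm (T a) <= (K1 + K2) * nrm a.
  move=> ra.
  have : nrm (T a + T a) <= nrm (herm_part T a) + nrm (herm_part T' a).
    rewrite -(nrm_iZ (herm_part T' a)).
    apply: le_trans (nrmB _ _); rewrite /herm_part /= star_iZ scalerDr scalerN.
    by rewrite !iZiZ opprK opprD opprK addrACA subrr addr0.
  rewrite -mulr2n -scaler_nat -(rmorph_nat (@real_complex R)) nrmZ ger0_norm//.
  have := h1 a ra; have := h2 a ra.
  have := nrm_ge0 a; have := nrm_ge0 (T a); lra.
have Tb x : nrm (T x) <= (2 * (K1 + K2)) * nrm x.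
  pose x1 := (2^-1)%:C *: (x + star x).
  pose x2 := 'i *: ((2^-1)%:C *: (x - star x)).
  have r1 : rsa x1 by apply/rsaZ/star_rsa; rewrite starD starK addrC.
  have r2 : rsa x2.
    apply: star_rsa; rewrite star_iZ starZ starD starN starK.
    by rewrite -scalerN -scalerN opprB.
  have half : `|2^-1 : R| = 2^-1 by rewrite ger0_norm// invr_ge0.
  have n1 : nrm x1 <= nrm x.
    rewrite nrmZ half; have := nrmD x (star x); have := nrm_star x; lra.
  have n2 : nrm x2 <= nrm x.
    rewrite nrm_iZ nrmZ half; have := nrmB x (star x); have := nrm_star x; lra.
  have xE : x = x1 - 'i *: x2.
    by rewrite iZiZ opprK -scalerDr addrACA subrr addr0 half_double.
  clearbody x1 x2.
  rewrite [in T x]xE linearB linearZ/=; apply: le_trans (nrmB _ _) _.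
  rewrite nrm_iZ.
  have K0 : 0 <= K1 + K2 by lra.
  have := le_trans (Tsa x1 r1) (ler_wpM2l K0 n1).
  have := le_trans (Tsa x2 r2) (ler_wpM2l K0 n2).
  by rewrite -mulrA; lra.
have /bounded_linearP[] // : (T : M -> M) \in bounded_linear M M.
apply: (@linear_bound_bounded _ _ _ _ (2 * (K1 + K2))%:C); first exact: linearP.
by move=> x; rewrite !nrmE -rmorphM lecR.
Qed.

(** Multiply [T p a + p T a = 0] on the right by [p]. *)
Lemma derivation_at_zero_null_compression (T : {linear M -> M}) :
  derivation_at_zero T -> null_compression T.
Proof.
move=> dT p a _ pa ap.
have := congr1 (fun b => b * p) (dT p a pa).
by rewrite mulrDl mul0r -(mulrA (T p)) ap mulr0 add0r.
Qed.

(** Here [{a, p, p} = 0]; multiply the resulting identity by [p] on either side. *)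
Lemma triple_derivation_at_zero_null_compression (T : {linear M -> M}) :
  triple_derivation_at_zero T -> null_compression T.
Proof.
move=> dT p a [rp pp] pa ap.
have sp : star p = p by exact: rsa_star.
have := dT a p p; rewrite /triple sp ap pp pa mul0r addr0 scaler0 => /(_ erefl).
rewrite -!scalerDr => /(congr1 (fun b => (2 : R[i]) *: (p * b * p))).
rewrite mulr0 mul0r scaler0 -vn_scaleAr -vn_scaleAl scalerA.
rewrite divff ?scale1r ?pnatr_eq0//.
rewrite !(mulrDl, mulrDr) -!mulrA ap pp !(mulr0, addr0) !mulrA pp pa.
rewrite !mul0r mulr0 !mul0r !addr0 -(mulrA (p * T a)) pp => h.
by rewrite -[LHS]half_double h scaler0.
Qed.

Lemma vector_functional_subproof (y z : H) :
  (fun a : M => dot H (a y) z : R[i]^o) \in bounded_linear M R[i]^o.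
Proof.
apply: (@linear_bound_bounded _ _ _ _ (2 * (nrm y * nrm z))%:C) => [k a b|a].
  by rewrite opD opZ linearDl linearZl_LR.
apply: le_trans (norm_dot_le _ _) _; rewrite nrmE -rmorphM lecR.
have := ler_wpM2r (nrm_ge0 z) (nrm_app a y).
by rewrite -!mulrA; lra.
Qed.

(** As for derivations at zero, with the additional term [p xi a]; multiplied by
    [p] on the right it vanishes because [a p = 0]. Products with [xi] live in
    the bidual, so the identity is evaluated at [psi = (x |-> <x p y, z>)], and
    [z] is taken to be [p (T a) p y]. *)
Lemma generalized_derivation_null_compression (T : {linear M -> M}) :
  generalized_derivation T -> null_compression T.
Proof.
move=> [xi dT] p a _ pa ap; apply: op_ext => y.
set b := p * T a * p; rewrite op0; apply/nrm0_eq0/eqP.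
rewrite -sqrf_eq0 -ripxx /rip.
pose phi : dual M := Bounded (vector_functional_subproof y (b y)).
suff : phi b = 0 by move=> /= ->.
pose psi : dual M := bidual_act (embed p) phi.
have := dT p a; rewrite pa linear0 => /(congr1 (fun f : bidual M => f psi)).
have psi0 : bidual_act (embed a) psi = 0.
  apply/val_inj/funext => x; rewrite -[LHS]/(phi (x * a * p)).
  by rewrite -mulrA ap mulr0 linear0.
rewrite -[RHS]/(phi (T p * a * p) + phi (p * T a * p) -
  arens (embed p) xi (bidual_act (embed a) psi)).
rewrite psi0 linear0 subr0 -mulrA ap mulr0 linear0 add0r => <-.
by rewrite -[LHS]/(phi (0 * p)) mul0r linear0.
Qed.
End Continuity.

Theorem corollary2p13 (R : realType) (H : hilbert R) (M : vonNeumann H)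
    (T : {linear M -> M}) :
  (generalized_derivation T -> continuous T) /\
  (derivation_at_zero T -> continuous T) /\
  (triple_derivation_at_zero T -> continuous T).
Proof.
split; [|split]; move=> hT; apply: null_compression_continuous.
- exact: generalized_derivation_null_compression.
- exact: derivation_at_zero_null_compression.
- exact: triple_derivation_at_zero_null_compression.
Qed.
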